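(* Let $(A,\|\cdot\|)$ be a non-unital, semisimple complex Banach algebra with unitization $A_e = A\oplus\mathbb{C}1$. Suppose that $A$ has the spectral extension property (SEP). Then the following are equivalent. (1) $A_e$ has SEP. (2) $A$ is closed in $(A_e,|\cdot|)$ for every norm $|\cdot|$ on $A_e$. (3) For every norm $|\cdot|$ on $A$ and every $a\in A$, $0\in\overline{co}\,V_A(a)$, where $V_A(a)$ is the spatial numerical range of $a$ in $(A,|\cdot|)$. (4) For every minimal norm $|\cdot|$ on $A_e$, the norms $|\cdot|_{op}$ and $|\cdot|_1$ on $A_e$ are equivalent.
   Context: All algebras are associative and complex. A ''norm'' on an algebra always means a submultiplicative vector-space norm; it need not be complete and need not be related to any given norm. For a non-unital Banach algebra $(A,\|\cdot\|)$, the unitization $A_e=A\oplus\mathbb{C}1$ is a Banach algebra under $\|a+\lambda1\|_1=\|a\|+|\lambda|$. $r_A(a)$ is the spectral radius of $a$ in $A$ (the spectrum of $a$ is computed in $A_e$ if $A$ has no identity). Semisimple means that the Jacobson radical is $\{0\}$. SEP: a Banach algebra $B$ is a super Banach algebra of a Banach algebra $A$ if $A$ is a (not necessarily closed) subalgebra of $B$ (no relation between the norms is required). $A$ has the spectral extension property (SEP) if $r_A(a)=r_B(a)$ for all $a\in A$ and every super Banach algebra $B$ of $A$. Minimal norm: a norm $|\cdot|$ on an algebra is minimal if every norm $|||\cdot|||$ on that algebra with $|||\cdot|||\le|\cdot|$ pointwise satisfies $|||\cdot|||=|\cdot|$. Operator norm and $\ell^1$-norm: for a norm $|\cdot|$ on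 $A$ (if $|\cdot|$ is a norm on $A_e$, use its restriction to $A$), for $a+\lambda1\in A_e$, $|a+\lambda1|_{op}=\sup\{|ax+\lambda x|:x\in A,\ |x|\le1\}$ and $|a+\lambda1|_1=|a|+|\lambda|$. Spatial numerical range: for a normed algebra $(A,|\cdot|)$ with Banach space dual $A^*$ and $a\in A$, $V_A(a)=\{\varphi(ax): x\in A,\ |x|=1,\ \varphi\in A^*,\ \|\varphi\|=1=\varphi(x)\}$. It depends on the norm. For $K\subset\mathbb{C}$, $\overline{co}\,K$ is the closure of the convex hull of $K$. *)

(* Defs.v *)
From HB Require Import structures.
From mathcomp Require Import all_boot all_order all_algebra.
From mathcomp Require Import complex.
From mathcomp Require Import all_classical all_reals all_analysis.

Set Implicit Arguments.
Unset Strict Implicit.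
Unset Printing Implicit Defensive.

Import Order.TTheory GRing.Theory Num.Theory numFieldNormedType.Exports.
Import Normc.

Local Open Scope classical_set_scope.
Local Open Scope ring_scope.

(* MathComp's algebra structures all have an identity, hence this one. *)
HB.mixin Record Lmodule_isAssocAlgebra (K : comNzRingType) A
    & GRing.Lmodule K A := {
  amul : A -> A -> A;
  amulA : associative amul;
  amulDl : left_distributive amul +%R;
  amulDr : right_distributive amul +%R;
  amulZl : forall (k : K) (x y : A), amul (k *: x) y = k *: amul x y;
  amulZr : forall (k : K) (x y : A), amul x (k *: y) = k *: amul x y
}.

#[short(type="assocAlgType")]
HB.structure Definition AssocAlgebra (K : comNzRingType) :=
  {A of GRing.Lmodule K A & Lmodule_isAssocAlgebra K A}.

Reserved Notation "x *a y" (at level 40, left associativity).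
Notation "x *a y" := (amul x y) : ring_scope.

Section AlgebraicNotions.
Variables (K : comNzRingType) (A : assocAlgType K).
Implicit Types (x y a b e u : A) (L M : set A).

Definition is_identity e := forall x, e *a x = x /\ x *a e = x.

(* The zero algebra counts as unital. *)
Definition has_identity := exists e, is_identity e.

Definition invertible_for e a := exists b, a *a b = e /\ b *a a = e.

Definition left_ideal L :=
  [/\ L 0,
      forall x y, L x -> L y -> L (x + y),
      forall (k : K) x, L x -> L (k *: x)
    & forall a x, L x -> L (a *a x)].

Definition modular_left_ideal L :=
  left_ideal L /\ exists u, forall x, L (x - x *a u).

Definition maximal_modular_left_ideal L :=
  [/\ modular_left_ideal L, L <> setT
    & forall M, left_ideal M -> L `<=` M -> M = L \/ M = setT].

Definition jacobson_radical : set A :=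
  \bigcap_(L in maximal_modular_left_ideal) L.

Definition semisimple := jacobson_radical = [set 0].

End AlgebraicNotions.

Arguments has_identity {K} A.
Arguments semisimple {K} A.

(* The pair (a, k) stands for a + k 1. *)
Definition unitization (K : comNzRingType) (A : assocAlgType K) : Type :=
  (A * K^o)%type.

Section Unitization.
Variables (K : comNzRingType) (A : assocAlgType K).
Local Notation Ae := (unitization A).

HB.instance Definition _ :=
  GRing.Lmodule.copy (unitization A) (A * K^o)%type.

Definition unitization_mul (x y : Ae) : Ae :=
  (x.1 *a y.1 + (y.2 : K) *: x.1 + (x.2 : K) *: y.1, x.2 * y.2).

Fact unitization_mulA : associative unitization_mul.
Proof.
move=> [a k] [b l] [c m]; congr pair => /=; last by rewrite mulrA.
rewrite !amulDr !amulDl !amulZr !amulZl amulA !scalerDr !scalerA.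
rewrite -!addrA (mulrC m l) (mulrC m k); congr (_ + _).
rewrite addrCA; congr (_ + _); rewrite [RHS]addrCA; congr (_ + _).
exact: addrCA.
Qed.

Fact unitization_mulDl : left_distributive unitization_mul +%R.
Proof.
move=> [a k] [b l] [c m]; congr pair => /=; last by rewrite mulrDl.
rewrite amulDl scalerDr scalerDl [RHS]addrACA.
by congr (_ + _); apply: addrACA.
Qed.

Fact unitization_mulDr : right_distributive unitization_mul +%R.
Proof.
move=> [a k] [b l] [c m]; congr pair => /=; last by rewrite mulrDr.
rewrite amulDr scalerDr scalerDl [RHS]addrACA.
by congr (_ + _); apply: addrACA.
Qed.

Fact unitization_mulZl (c : K) (x y : Ae) :
  unitization_mul (c *: x) y = c *: unitization_mul x y.
Proof.
case: x y => [a k] [b l]; congr pair => /=; last by rewrite -scalerAl.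
by rewrite amulZl !scalerDr !scalerA (mulrC l c).
Qed.

Fact unitization_mulZr (c : K) (x y : Ae) :
  unitization_mul x (c *: y) = c *: unitization_mul x y.
Proof.
case: x y => [a k] [b l]; congr pair => /=; last by rewrite -scalerAr.
by rewrite amulZr !scalerDr !scalerA (mulrC k c).
Qed.

HB.instance Definition _ := Lmodule_isAssocAlgebra.Build K (unitization A)
  unitization_mulA unitization_mulDl unitization_mulDr
  unitization_mulZl unitization_mulZr.

Definition to_unitization (a : A) : Ae := (a, 0).

Definition unitization1 : Ae := (0, 1).

End Unitization.

Arguments unitization1 {K} A.

Section Norms.
Variables (R : realType) (A : assocAlgType R[i]).
Implicit Types (p q : A -> R) (u : nat -> A).

(* Norms are bare functions, since several of them live on the same algebra. *)
Definition algebra_norm p :=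
  [/\ forall x, 0 <= p x,
      forall x, p x = 0 -> x = 0,
      forall x y, p (x + y) <= p x + p y,
      forall (k : R[i]) x, p (k *: x) = normc k * p x
    & forall x y, p (x *a y) <= p x * p y].

Definition cauchy_for p u := forall e : R, 0 < e ->
  exists N, forall m n, (N <= m)%N -> (N <= n)%N -> p (u m - u n) < e.

Definition cvg_for p u (l : A) := forall e : R, 0 < e ->
  exists N, forall n, (N <= n)%N -> p (u n - l) < e.

Definition complete_for p := forall u, cauchy_for p u -> exists l, cvg_for p u l.

Definition closed_for p (S : set A) := forall x,
  (forall e : R, 0 < e -> exists2 y, S y & p (x - y) < e) -> S x.

Definition minimal_norm p := algebra_norm p /\
  forall q, algebra_norm q -> (forall x, q x <= p x) -> forall x, q x = p x.

Definition equivalent_norms p q := exists c C : R,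
  [/\ 0 < c, 0 < C & forall x, c * p x <= q x /\ q x <= C * p x].

End Norms.

HB.mixin Record AssocAlgebra_isBanach (R : realType) A
    & AssocAlgebra R[i] A := {
  bnorm : A -> R;
  bnorm_algebra_norm : algebra_norm bnorm;
  bnorm_complete : complete_for bnorm
}.

#[short(type="banachAlgType")]
HB.structure Definition BanachAlgebra (R : realType) :=
  {A of AssocAlgebra R[i] A & AssocAlgebra_isBanach R A}.

Section UnitizationNorms.
Variables (R : realType) (A : assocAlgType R[i]).
Implicit Types (p : A -> R) (x : unitization A).

Definition ell1_norm p x : R := p x.1 + normc (x.2 : R[i]).

Definition op_norm p x : R :=
  sup [set p (x.1 *a y + (x.2 : R[i]) *: y) | y in [set y | p y <= 1]].

End UnitizationNorms.

Section UnitizationBanach.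
Variable R : realType.

Fact complex_normE (z : R[i]) : `|z| = (normc z)%:C%C.
Proof. by []. Qed.

Fact normc_ge0 (z : R[i]) : 0 <= normc z.
Proof. by case: z => a b; exact: sqrtr_ge0. Qed.

Fact normcD (x y : R[i]) : normc (x + y) <= normc x + normc y.
Proof. by rewrite -lecR rmorphD -!complex_normE ler_normD. Qed.

Fact le_Re_normc (z : R[i]) : `|complex.Re z| <= normc z.
Proof.
by case: z => a b /=; rewrite -sqrtr_sqr ler_sqrt ?addr_ge0 ?sqr_ge0 //
  lerDl sqr_ge0.
Qed.

Fact le_Im_normc (z : R[i]) : `|complex.Im z| <= normc z.
Proof.
by case: z => a b /=; rewrite -sqrtr_sqr ler_sqrt ?addr_ge0 ?sqr_ge0 //
  lerDr sqr_ge0.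
Qed.

Fact normc_le (z : R[i]) : normc z <= `|complex.Re z| + `|complex.Im z|.
Proof.
case: z => a b /=; rewrite -(ger0_norm (addr_ge0 (normr_ge0 a) (normr_ge0 b))).
rewrite -sqrtr_sqr ler_sqrt ?sqr_ge0 // sqrrD !real_normK ?num_real //.
by rewrite -addrA addrCA addrC lerDl mulrn_wge0 // mulr_ge0.
Qed.

Fact real_complete (u : nat -> R) :
  (forall e : R, 0 < e -> exists N, forall m n, (N <= m)%N -> (N <= n)%N ->
     `|u m - u n| < e) ->
  exists l, forall e : R, 0 < e -> exists N, forall n, (N <= n)%N ->
     `|u n - l| < e.
Proof.
move=> uC; have /cvg_ex[l ul] : cvg (u @ \oo).
  apply/cauchy_cvgP/cauchy_exP => e e0; have [N uN] := uC e e0.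
  by exists (u N), N => // n /= Nn; apply: uN.
exists l => e e0; have /cvgr_distC_lt/(_ e e0)[N _ uN] := ul.
by exists N => n Nn; apply: uN.
Qed.

Fact normc_complete (u : nat -> R[i]) :
  (forall e : R, 0 < e -> exists N, forall m n, (N <= m)%N -> (N <= n)%N ->
     normc (u m - u n) < e) ->
  exists l, forall e : R, 0 < e -> exists N, forall n, (N <= n)%N ->
     normc (u n - l) < e.
Proof.
move=> uC.
have [|a ua] := @real_complete (fun n => complex.Re (u n)).
  move=> e e0; have [N uN] := uC e e0; exists N => m n Nm Nn.
  by apply: le_lt_trans (uN m n Nm Nn); rewrite -raddfB le_Re_normc.
have [|b ub] := @real_complete (fun n => complex.Im (u n)).
  move=> e e0; have [N uN] := uC e e0; exists N => m n Nm Nn.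
  by apply: le_lt_trans (uN m n Nm Nn); rewrite -raddfB le_Im_normc.
exists (a +i* b)%C => e e0; have e20 : 0 < e / 2 by rewrite divr_gt0.
have [N1 h1] := ua _ e20; have [N2 h2] := ub _ e20.
exists (maxn N1 N2) => n; rewrite geq_max => /andP[n1 n2].
apply: le_lt_trans (normc_le _) _; rewrite !raddfB /= [ltRHS]splitr.
by apply: ltrD; [apply: h1|apply: h2].
Qed.

Variable A : banachAlgType R.

Fact ell1_algebra_norm : algebra_norm (ell1_norm (@bnorm R A)).
Proof.
have [p0 pI pD pZ pM] := @bnorm_algebra_norm R A; split.
- by move=> x; rewrite addr_ge0 ?p0 ?normc_ge0.
- move=> [a k] /eqP; rewrite /ell1_norm /= paddr_eq0 ?p0 ?normc_ge0 //.
  by move=> /andP[/eqP/pI -> /eqP/eq0_normc ->].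
- move=> [a k] [b l]; rewrite /ell1_norm /=.
  by rewrite addrACA lerD ?pD ?normcD.
- by move=> c [a k]; rewrite /ell1_norm /= pZ normcM mulrDr.
- move=> [a k] [b l]; rewrite /ell1_norm /= normcM mulrDl !mulrDr addrA.
  rewrite lerD2r; apply: le_trans (pD _ _) _; rewrite pZ lerD2r.
  by apply: le_trans (pD _ _) _; rewrite pZ [normc l * _]mulrC lerD2r.
Qed.

Fact ell1_complete : complete_for (ell1_norm (@bnorm R A)).
Proof.
have [p0 _ _ _ _] := @bnorm_algebra_norm R A.
move=> u uC.
have [|a ua] := @bnorm_complete R A (fun n => (u n).1).
  move=> e e0; have [N uN] := uC e e0; exists N => m n Nm Nn.
  by apply: le_lt_trans (uN m n Nm Nn); rewrite lerDl normc_ge0.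
have [|k uk] := @normc_complete (fun n => (u n).2).
  move=> e e0; have [N uN] := uC e e0; exists N => m n Nm Nn.
  by apply: le_lt_trans (uN m n Nm Nn); rewrite lerDr p0.
exists (a, k) => e e0; have e20 : 0 < e / 2 by rewrite divr_gt0.
have [N1 h1] := ua _ e20; have [N2 h2] := uk _ e20.
exists (maxn N1 N2) => n; rewrite geq_max => /andP[n1 n2].
by rewrite [ltRHS]splitr; apply: ltrD; [apply: h1|apply: h2].
Qed.

HB.instance Definition _ := AssocAlgebra_isBanach.Build R (unitization A)
  ell1_algebra_norm ell1_complete.

End UnitizationBanach.

Section SpectralRadius.
Variables (R : realType) (A : assocAlgType R[i]).

Definition spectrum (a : A) : set R[i] := [set k |
  (exists2 e : A, is_identity e & ~ invertible_for e (a - k *: e)) \/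
  (~ has_identity A /\ ~ invertible_for (unitization1 A)
                           (to_unitization a - k *: unitization1 A))].

Definition spectral_radius (a : A) : R := sup [set normc k | k in spectrum a].

End SpectralRadius.

(* B is a super Banach algebra of A through the embedding f; an identity of A *)
(* need not be an identity of B.                                              *)
Definition algebra_embedding (K : comNzRingType) (A B : assocAlgType K)
    (f : {linear A -> B}) :=
  injective f /\ forall x y, f (x *a y) = f x *a f y.

Definition SEP (R : realType) (A : banachAlgType R) :=
  forall (B : banachAlgType R) (f : {linear A -> B}), algebra_embedding f ->
  forall a, spectral_radius a = spectral_radius (f a).

Section SpatialNumericalRange.
Variables (R : realType) (A : assocAlgType R[i]).
Implicit Types (p : A -> R) (phi : {linear A -> R[i]^o}).

Definition bounded_functional p phi :=
  exists M : R, forall x, normc (phi x : R[i]) <= M * p x.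

Definition dual_norm p phi : R :=
  sup [set normc (phi x : R[i]) | x in [set x | p x <= 1]].

Definition spatial_range p (a : A) : set R[i] := [set z |
  exists x phi, [/\ p x = 1, bounded_functional p phi, dual_norm p phi = 1,
                    phi x = 1 & z = phi (a *a x)]].

End SpatialNumericalRange.

Section ConvexHull.
Variable R : realType.

(* In R[i] the inequalities 0 <= t <= 1 force t to be real, so convexity over *)
(* the scalars R[i] is ordinary convexity.                                    *)
Definition convex_hull (S : set R[i]) : set R[i] :=
  \bigcap_(C in [set C : set (convex_lmodType R[i]^o) |
                   convex_set C /\ S `<=` C]) C.

Definition closed_convex_hull (S : set R[i]) : set R[i] :=
  closure (convex_hull S : set R[i]^o).

End ConvexHull.

(* Main.v *)
(* The tool throughout is the pointwise bound |k| <= p(a) for k in the spectrum of a and p any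
   algebra norm: SEP gives it, by passing to the completion of p.

   (1) => (2): if 1 is in the closure of A, some z = 1 - a has p(z) < 1, so 1 is not in the
   spectrum of z, which is absurd modulo A.
   (2) => (3): by (2) for the operator norm, |l| <= |a + l|_op. If 0 is not in the closed convex
   hull of V(a), rotate a so that Re V(a) >= c > 0; Hahn-Banach gives
   |(1 + ta)y| >= (1 + tc)|y|, hence |1 - ta|_op <= (1 + t^2 |a^2|)/(1 + tc) < 1 for small t.
   (3) => (4): (3) gives |l| <= |a + l|_op, and a minimal norm equals its operator norm.
   (4) => (2): by Zorn every norm dominates a minimal one; the infimum of a chain of norms is
   definite because of the spectral bound and semisimplicity.
   (2) => (1): for x = a + l and k in the spectrum of x, k^n - l^n is in the spectrum of
   x^n - l^n, an element of A, so |k|^n <= (2 + q(1)) q(x^n) for every norm q; the spectral radius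
   formula in the super algebra concludes. That formula is proved without complex analysis, from
   the identity (1 - w^2)^-1 = ((1 - w)^-1 + (1 + w)^-1)/2 and compactness of the unit disc. *)
Require Import Defs.
From HB Require Import structures.
From mathcomp Require Import all_boot all_order all_algebra.
From mathcomp Require Import complex.
From mathcomp Require Import all_classical all_reals all_analysis.
From mathcomp Require Import ring lra.
Import Order.TTheory GRing.Theory Num.Theory numFieldNormedType.Exports.
Import Normc.
Local Open Scope classical_set_scope.
Local Open Scope ring_scope.

Set Implicit Arguments.
Unset Strict Implicit.
Unset Printing Implicit Defensive.

(** * Arithmetic in algebras without identity *)

Section NonunitalArithmetic.
Variables (K : comNzRingType) (A : assocAlgType K).
Implicit Types (x y z : A).

Lemma amul0x x : 0 *a x = 0.
Proof. by apply: (addrI (0 *a x)); rewrite -amulDl !addr0. Qed.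

Lemma amulx0 x : x *a 0 = 0.
Proof. by apply: (addrI (x *a 0)); rewrite -amulDr !addr0. Qed.

Lemma amulNx x y : (- x) *a y = - (x *a y).
Proof. by apply: (addrI (x *a y)); rewrite -amulDl !subrr amul0x. Qed.

Lemma amulxN x y : x *a (- y) = - (x *a y).
Proof. by apply: (addrI (x *a y)); rewrite -amulDr !subrr amulx0. Qed.

Lemma amulBl x y z : (x - y) *a z = x *a z - y *a z.
Proof. by rewrite amulDl amulNx. Qed.

Lemma amulBr x y z : x *a (y - z) = x *a y - x *a z.
Proof. by rewrite amulDr amulxN. Qed.

End NonunitalArithmetic.

(** * The unitization as a unital ring and algebra *)

Section UnitizationRing.
Variables (K : comNzRingType) (A : assocAlgType K).
Local Notation Ae := (unitization A).

Lemma unitization_identity : is_identity (unitization1 A : Ae).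
Proof.
move=> [a k]; split; congr pair => /=; rewrite ?mul1r ?mulr1 //.
  by rewrite amul0x scaler0 scale1r !add0r.
by rewrite amulx0 scaler0 scale1r addr0 add0r.
Qed.

Fact unitization_mul1 : left_id (unitization1 A : Ae) (@unitization_mul K A).
Proof. by move=> x; case: (unitization_identity x). Qed.

Fact unitization_mulr1 : right_id (unitization1 A : Ae) (@unitization_mul K A).
Proof. by move=> x; case: (unitization_identity x). Qed.

Fact unitization1_neq0 : (unitization1 A : Ae) != 0.
Proof. by apply/eqP => /(congr1 snd) /eqP; rewrite oner_eq0. Qed.

HB.instance Definition _ := GRing.Zmodule_isNzRing.Build (unitization A)
  (@unitization_mulA K A) unitization_mul1 unitization_mulr1
  (@unitization_mulDl K A) (@unitization_mulDr K A) unitization1_neq0.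

Fact unitization_scalerAl (k : K) (x y : Ae) : k *: (x * y) = (k *: x) * y.
Proof. by rewrite -[RHS]/(unitization_mul _ _) unitization_mulZl. Qed.

HB.instance Definition _ :=
  GRing.Lmodule_isLalgebra.Build K (unitization A) unitization_scalerAl.

Fact unitization_scalerAr (k : K) (x y : Ae) : k *: (x * y) = x * (k *: y).
Proof. by rewrite -[RHS]/(unitization_mul _ _) unitization_mulZr. Qed.

HB.instance Definition _ :=
  GRing.Lalgebra_isAlgebra.Build K (unitization A) unitization_scalerAr.

Lemma amul_unitization (x y : Ae) : x *a y = x * y.
Proof. by []. Qed.

Lemma unitization_mulE (x y : Ae) :
  x * y = (x.1 *a y.1 + (y.2 : K) *: x.1 + (x.2 : K) *: y.1, x.2 * y.2).
Proof. by []. Qed.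

Lemma to_unitization_is_linear : linear (@to_unitization K A).
Proof. by move=> k a b; congr pair; rewrite /= scaler0 addr0. Qed.

HB.instance Definition _ := GRing.isLinear.Build K A (unitization A) _
  (@to_unitization K A) to_unitization_is_linear.

Lemma to_unitizationD (a b : A) :
  to_unitization (a + b) = to_unitization a + to_unitization b.
Proof. exact: linearD. Qed.

Lemma to_unitizationZ (k : K) (a : A) :
  to_unitization (k *: a) = k *: to_unitization a.
Proof. exact: linearZ. Qed.

Lemma to_unitization_inj : injective (@to_unitization K A).
Proof. by move=> a b []. Qed.

Lemma to_unitizationM (a b : A) :
  to_unitization (a *a b) = to_unitization a * to_unitization b.
Proof. by rewrite unitization_mulE /= !scale0r !addr0 mulr0. Qed.

Lemma unitization_eta (x : Ae) :
  x = to_unitization x.1 + (x.2 : K)%:A.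
Proof.
case: x => a k; congr pair; rewrite /= ?scaler0 ?addr0 //.
by rewrite add0r; exact/esym/mulr1.
Qed.

Lemma snd_unitizationX (x : Ae) n : (x ^+ n).2 = (x.2 : K) ^+ n.
Proof. by elim: n => // n ih; rewrite !exprS -ih. Qed.

Lemma range_to_unitization : range (@to_unitization K A) = [set x | x.2 = 0].
Proof.
by apply/seteqP; split=> [_ [a _ <-]//|[a k] /= ->]; exists a.
Qed.

End UnitizationRing.

(** * Quasi-inverses and the spectrum *)

Section QuasiInvertible.
Variables (K : fieldType) (A : assocAlgType K).
Implicit Types (a c e y : A) (k : K).

(** Expresses that 1 + y inverts 1 - c, without mentioning an identity. *)
Definition quasi_invertible c :=
  exists y, y = c + c *a y /\ y = c + y *a c.

Lemma invertible_forZ e a k : k != 0 ->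
  invertible_for e (k *: a) <-> invertible_for e a.
Proof.
move=> k0; split=> -[b [ab ba]].
  by exists (k *: b); rewrite amulZl amulZr -amulZl ab -ba amulZr.
exists (k^-1 *: b); rewrite !amulZl !amulZr !scalerA mulfV ?mulVf //.
by rewrite !scale1r.
Qed.

Lemma invertible_for_quasi e c : is_identity e ->
  invertible_for e (e - c) <-> quasi_invertible c.
Proof.
move=> eP; have el x : e *a x = x by case: (eP x).
have er x : x *a e = x by case: (eP x).
split=> [[b []]|[y [y1 y2]]].
  rewrite amulBl amulBr el er => b1 b2; exists (b - e).
  rewrite amulBr amulBl el er; split; apply/eqP.
    by rewrite [c + _]addrC subrK subr_eq -b1 addrC subrK.
  by rewrite [c + _]addrC subrK subr_eq -b2 addrC subrK.
exists (e + y); split.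
  by rewrite amulBl el amulDr er -y1 addrK.
by rewrite amulBr er amulDl el -y2 addrK.
Qed.

Lemma invertible_for_sub_scale e a k : is_identity e -> k != 0 ->
  invertible_for e (a - k *: e) <-> quasi_invertible (k^-1 *: a).
Proof.
move=> eP k0; rewrite -(invertible_for_quasi _ eP).
have -> : a - k *: e = (- k) *: (e - k^-1 *: a).
  by rewrite scalerBr scalerA mulNr mulfV // scaleN1r opprK scaleNr addrC.
by apply: invertible_forZ; rewrite oppr_eq0.
Qed.

End QuasiInvertible.

(** A quasi-inverse of an element of A has scalar part 0, so it already lies in A. *)
Lemma quasi_invertible_unitization (K : fieldType) (A : assocAlgType K) (c : A) :
  quasi_invertible (to_unitization c) <-> quasi_invertible c.
Proof.
split=> [[[y k]] [/[dup]] /(congr1 fst)/=|[y [y1 y2]]].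
  move=> y1 /(congr1 snd)/=; rewrite mul0r addr0 => k0.
  move=> /(congr1 fst)/=; move: y1; rewrite k0 !scale0r !addr0 => y1 y2.
  by exists y.
by exists (to_unitization y); rewrite !amul_unitization -!to_unitizationM
  -!linearD -?y1 -?y2.
Qed.

Lemma quasi_invertible_morph (K : fieldType) (A B : assocAlgType K)
    (f : {linear A -> B}) : (forall x y, f (x *a y) = f x *a f y) ->
  forall c, quasi_invertible c -> quasi_invertible (f c).
Proof.
by move=> fM c [y [y1 y2]]; exists (f y); rewrite -!fM -!linearD -y1 -y2.
Qed.

Section Spectrum.
Variables (R : realType) (A : assocAlgType R[i]).
Implicit Types (a : A) (k : R[i]).

(** Merges the unital and the non-unital clause of [spectrum] into one condition inside A. *)
Lemma spectrum_quasi a k : k != 0 ->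
  spectrum a k <-> ~ quasi_invertible (k^-1 *: a).
Proof.
move=> k0; have [[e eP]|nunit] := pselect (has_identity A).
  split=> [[[e' e'P]|[]]|na].
  - by rewrite (invertible_for_sub_scale _ e'P k0).
  - by move=> /(_ (ex_intro _ e eP)).
  - by left; exists e => //; rewrite (invertible_for_sub_scale _ eP k0).
have aP : invertible_for (unitization1 A) (to_unitization a - k *: unitization1 A)
    <-> quasi_invertible (k^-1 *: a).
  rewrite (invertible_for_sub_scale _ (@unitization_identity _ A) k0).
  by rewrite -linearZ quasi_invertible_unitization.
by rewrite -aP; split=> [[[e eP]|[]//]|na]; [case: nunit; exists e|right].
Qed.

End Spectrum.

(** * Metric consequences of the norm axioms *)

Section AlgebraNorm.
Variables (R : realType) (A : assocAlgType R[i]) (p : A -> R).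
Hypothesis pN : algebra_norm p.
Implicit Types (x y : A) (k : R[i]).

Lemma anorm_ge0 x : 0 <= p x. Proof. by case: pN. Qed.

Lemma anorm_eq0 x : p x = 0 -> x = 0. Proof. by case: pN => ? + _ _ _; apply. Qed.

Lemma ler_anormD x y : p (x + y) <= p x + p y. Proof. by case: pN. Qed.

Lemma anormZ k x : p (k *: x) = normc k * p x. Proof. by case: pN. Qed.

Lemma ler_anormM x y : p (x *a y) <= p x * p y. Proof. by case: pN. Qed.

Lemma anorm0 : p 0 = 0.
Proof. by rewrite -(scale0r 0) anormZ normc0 mul0r. Qed.

Lemma anormN x : p (- x) = p x.
Proof. by rewrite -scaleN1r anormZ normcN normc1 mul1r. Qed.

Lemma anormC x y : p (x - y) = p (y - x).
Proof. by rewrite -opprB anormN. Qed.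

Lemma anorm_gt0 x : x <> 0 -> 0 < p x.
Proof.
by move=> x0; rewrite lt_def anorm_ge0 andbT; apply/eqP => /anorm_eq0.
Qed.

Lemma ler_anorm_dist x y z : p (x - z) <= p (x - y) + p (y - z).
Proof. by rewrite (le_trans _ (ler_anormD _ _)) // addrA subrK. Qed.

Lemma ler_anormB x y : p (x - y) <= p x + p y.
Proof. by rewrite -(anormN y) ler_anormD. Qed.

Lemma lerB_anorm x y : p x - p y <= p (x - y).
Proof. by rewrite lerBlDr (le_trans _ (ler_anormD _ _)) // subrK. Qed.

Lemma cvg_anorm_le u l x y (K : R) : 0 <= K -> cvg_for p u l ->
  (forall n, p (x - y) <= K * p (u n - l)) -> x = y.
Proof.
move=> K0 ul xy; apply/eqP; rewrite -subr_eq0; apply/eqP/anorm_eq0.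
apply/eqP; rewrite eq_le anorm_ge0 andbT; apply/ler_addgt0Pl => e e0.
rewrite addr0; have K1 : 0 < K + 1 by rewrite ltr_wpDl.
have [N /(_ N (leqnn N)) uN] := ul _ (divr_gt0 e0 K1).
apply: le_trans (xy N) _.
rewrite (@le_trans _ _ ((K + 1) * p (u N - l))) ?ler_wpM2r ?anorm_ge0 ?lerDl//.
by rewrite mulrC -ler_pdivlMr // ltW.
Qed.

Lemma geometric_cauchy u (r : R) : 0 <= r -> r < 1 ->
  (forall n, p (u n.+1 - u n) <= r ^+ n) -> cauchy_for p u.
Proof.
move=> r0 r1 ur e e0; have r1' : 0 < 1 - r by rewrite subr_gt0.
(* The geometric tail bound, multiplied by 1 - r so that it telescopes without division. *)
have tail (n j : nat) : p (u (n + j)%N - u n) * (1 - r) <= r ^+ n - r ^+ (n + j).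
  elim: j => [|j ih]; first by rewrite addn0 !subrr anorm0 mul0r.
  rewrite addnS; have := ler_anorm_dist (u (n + j).+1) (u (n + j)%N) (u n).
  rewrite -(ler_pM2r r1') => /le_trans; apply; rewrite mulrDl.
  rewrite -[r ^+ n](subrK (r ^+ (n + j))) -addrA addrC lerD //.
  by rewrite exprS -{1}[r ^+ _]mul1r -mulrBl mulrC ler_wpM2l // ltW.
have : (r ^+ n) @[n --> \oo] --> (0 : R) by apply: cvg_expr; rewrite ger0_norm.
have ee : 0 < e / 2 * (1 - r) by rewrite mulr_gt0 // divr_gt0.
move=> /cvgrPdist_lt /(_ _ ee) [N _ rN]; exists N => m n Nm Nn.
have small (j : nat) : (N <= j)%N -> p (u j - u N) < e / 2.
  move=> Nj; rewrite -(ltr_pM2r r1') -(subnKC Nj).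
  apply: le_lt_trans (tail _ _) _; apply: le_lt_trans (rN N (leqnn N)).
  by rewrite sub0r normrN ger0_norm ?exprn_ge0 // gerBl exprn_ge0.
apply: le_lt_trans (ler_anorm_dist _ (u N) _) _.
by rewrite (anormC (u N)) [ltRHS]splitr ltrD // small.
Qed.

End AlgebraNorm.

Lemma bnormN (R : realType) (B : banachAlgType R) : algebra_norm (@bnorm R B).
Proof. exact: bnorm_algebra_norm. Qed.

(** The partial sums [u n] = c + ... + c^n of the Neumann series are Cauchy, and their limit [l]
    solves l = c + c l. Each [u n] commutes with c, hence so does [l], which gives the second
    equation. *)
Lemma neumann (R : realType) (B : banachAlgType R) (c : B) :
  bnorm c < 1 -> quasi_invertible c.
Proof.
move=> c1; have pN := bnormN B; set p := @bnorm R B in pN c1 *.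
pose u := fix u n := if n is n.+1 then c + c *a u n else 0 : B.
have uC n : u n *a c = c *a u n.
  by elim: n => [|n ih] /=; rewrite ?amul0x ?amulx0 // amulDl amulDr -amulA ih.
have [|l ul] := @bnorm_complete R B u.
  apply: (@geometric_cauchy _ _ _ pN _ (p c)) => //; first exact: anorm_ge0.
  elim=> [|n ih] /=; first by rewrite amulx0 addr0 subr0 ltW.
  rewrite opprD addrACA subrr add0r -amulBr exprS.
  apply: le_trans (ler_anormM pN _ _) _.
  by rewrite ler_wpM2l ?anorm_ge0.
have lc : l *a c = c *a l.
  apply: (cvg_anorm_le pN (K := p c + p c) _ ul).
    by rewrite addr_ge0 ?anorm_ge0.
  move=> n; have -> : l *a c - c *a l = c *a (u n - l) - (u n - l) *a c.
    by rewrite amulBr amulBl uC opprB [RHS]addrC addrA subrK.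
  apply: le_trans (ler_anormB pN _ _) _; rewrite mulrDl lerD ?ler_anormM //.
  by rewrite mulrC ler_anormM.
have lE : l = c + c *a l.
  have vl : cvg_for p (fun n => u n.+1) l.
    by move=> e e0; have [N uN] := ul e e0; exists N => n /leqW /uN.
  apply/eqP; rewrite -subr_eq0; apply/eqP/(anorm_eq0 pN)/eqP.
  rewrite eq_le anorm_ge0 // andbT; apply/ler_addgt0Pl => e e0; rewrite addr0.
  have e2 : 0 < e / 2 by rewrite divr_gt0.
  have [N uN] := ul _ e2.
  apply: le_trans (ler_anorm_dist pN _ (u N.+1) _) _.
  rewrite [leRHS]splitr lerD //; first by rewrite anormC // ltW // uN.
  rewrite /= opprD addrACA subrr add0r -amulBr.
  apply: le_trans (ler_anormM pN _ _) _.
  by rewrite -[leRHS]mul1r ler_pM ?anorm_ge0 // ltW // uN.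
by exists l; rewrite lc.
Qed.

Lemma spectrum_bnorm (R : realType) (B : banachAlgType R) (b : B) k :
  spectrum b k -> normc k <= bnorm b.
Proof.
have pN := bnormN B.
have [->|k0] := eqVneq k 0; first by rewrite normc0 anorm_ge0.
rewrite spectrum_quasi // => kb; rewrite leNgt; apply/negP => bk; apply: kb.
apply: neumann; have nk : 0 < normc k by apply: le_lt_trans bk; rewrite anorm_ge0.
by rewrite anormZ // normcV // mulrC ltr_pdivrMr // mul1r.
Qed.

(** * The spectral radius in a Banach algebra *)

Section SpectralRadiusTheory.
Variables (R : realType) (B : banachAlgType R).
Implicit Types (b : B) (k : R[i]).

Lemma has_ubound_spectrum b : has_ubound [set normc k | k in spectrum b].
Proof. by exists (bnorm b) => _ [k bk <-]; apply: spectrum_bnorm. Qed.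

Lemma spectrum_radius b k : spectrum b k -> normc k <= spectral_radius b.
Proof. by move=> bk; apply: (ub_le_sup (has_ubound_spectrum b)); exists k. Qed.

Lemma spectral_radius_ge0 b : 0 <= spectral_radius b.
Proof.
have [[k bk]|b0] := pselect (exists k, spectrum b k).
  by apply: le_trans (spectrum_radius bk); exact: normc_ge0.
(* The supremum of an empty set is 0 by default. *)
rewrite /spectral_radius sup_out // => -[[_ [k bk _]] _].
by apply: b0; exists k.
Qed.

Lemma spectral_radius_le b (r : R) : 0 <= r ->
  (forall k, k != 0 -> r < normc k -> quasi_invertible (k^-1 *: b)) ->
  spectral_radius b <= r.
Proof.
move=> r0 br; have [b0|b0] := pselect ([set normc k | k in spectrum b] !=set0).
  apply: ge_sup => // _ [k bk <-]; rewrite leNgt; apply/negP => rk.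
  have k0 : k != 0 by apply: contraTneq rk => ->; rewrite normc0 -leNgt.
  by move: bk; rewrite spectrum_quasi //; apply; apply: br.
by rewrite /spectral_radius sup_out // => -[].
Qed.

Lemma spectral_radius_bnorm b : spectral_radius b <= bnorm b.
Proof.
apply: spectral_radius_le => [|k k0 bk]; first exact: anorm_ge0 (bnormN B) b.
apply: contrapT; rewrite -spectrum_quasi // => /spectrum_bnorm.
by rewrite leNgt bk.
Qed.

Lemma quasi_invertible_radius b k : k != 0 -> spectral_radius b < normc k ->
  quasi_invertible (k^-1 *: b).
Proof.
move=> k0 bk; apply: contrapT; rewrite -spectrum_quasi // => /spectrum_radius.
by rewrite leNgt bk.
Qed.

End SpectralRadiusTheory.

(** * Cauchy sequences for a bare norm *)

Section CauchySequences.
Variables (R : realType) (A : assocAlgType R[i]) (p : A -> R).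
Hypothesis pN : algebra_norm p.
Implicit Types (u v : nat -> A).

Lemma cvg_for_cvgn u l :
  cvg_for p u l <-> p (u n - l) @[n --> \oo] --> (0 : R).
Proof.
split=> [ul|/cvgrPdist_lt ul e e0].
  apply/cvgrPdist_lt => e e0; have [N uN] := ul e e0; exists N => // n /= Nn.
  by rewrite sub0r normrN ger0_norm ?anorm_ge0 // uN.
have [N _ uN] := ul e e0; exists N => n Nn; have := uN n Nn.
by rewrite /= sub0r normrN ger0_norm ?anorm_ge0.
Qed.

Lemma cauchy_for_cvg_anorm u : cauchy_for p u -> cvg (p (u n) @[n --> \oo]).
Proof.
move=> uC; have [|l ul] := @real_complete R (p \o u).
  move=> e e0; have [N uN] := uC e e0; exists N => m n Nm Nn /=.
  rewrite ltr_norml ltrNl opprB; apply/andP.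
  by split; apply: le_lt_trans (lerB_anorm pN _ _) _; rewrite uN.
apply/cvg_ex; exists l; apply/cvgrPdist_lt => e e0.
by have [N uN] := ul e e0; exists N => // n /= Nn; rewrite distrC uN.
Qed.

Lemma cauchy_for_bounded u : cauchy_for p u ->
  exists2 M : R, 0 < M & \forall n \near \oo, p (u n) <= M.
Proof.
move=> uC; have [N uN] := uC 1 ltr01; exists (1 + p (u N)).
  by rewrite ltr_pwDl // anorm_ge0.
exists N => // n /= Nn; rewrite -lerBlDr.
by apply: le_trans (lerB_anorm pN _ _) _; rewrite ltW // uN.
Qed.

Lemma cauchy_forM u v : cauchy_for p u -> cauchy_for p v ->
  cauchy_for p (fun n => u n *a v n).
Proof.
move=> uC vC e e0.
have [M M0 [Nu _ uM]] := cauchy_for_bounded uC.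
have [L L0 [Nv _ vL]] := cauchy_for_bounded vC.
have e2 : 0 < e / 2 by rewrite divr_gt0.
have [N1 h1] := vC _ (divr_gt0 e2 M0); have [N2 h2] := uC _ (divr_gt0 e2 L0).
exists (maxn (maxn Nu Nv) (maxn N1 N2)) => m n.
rewrite !geq_max => /andP[/andP[um vm] /andP[m1 m2]].
move=> /andP[/andP[un vn] /andP[n1 n2]].
apply: le_lt_trans (ler_anorm_dist pN _ (u m *a v n) _) _.
rewrite -amulBr -amulBl [ltRHS]splitr; apply: ltrD.
  apply: le_lt_trans (ler_anormM pN _ _) _.
  apply: le_lt_trans (ler_wpM2r (anorm_ge0 pN _) (uM _ um)) _.
  by rewrite mulrC -ltr_pdivlMr // h1.
apply: le_lt_trans (ler_anormM pN _ _) _.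
apply: le_lt_trans (ler_wpM2l (anorm_ge0 pN _) (vL _ vn)) _.
by rewrite -ltr_pdivlMr // h2.
Qed.

Lemma cauchy_for_cst a : cauchy_for p (fun=> a).
Proof. by move=> e e0; exists 0%N => m n _ _; rewrite subrr anorm0. Qed.

Lemma cauchy_for_lin k u v : cauchy_for p u -> cauchy_for p v ->
  cauchy_for p (k *: u + v).
Proof.
move=> uC vC e e0; have e2 : 0 < e / 2 by rewrite divr_gt0.
have k1 : 0 < normc k + 1 by rewrite ltr_wpDl ?normc_ge0.
have [N1 h1] := uC _ (divr_gt0 e2 k1); have [N2 h2] := vC _ e2.
exists (maxn N1 N2) => m n; rewrite !geq_max => /andP[m1 m2] /andP[n1 n2].
have -> : (k *: u + v) m - (k *: u + v) n = k *: (u m - u n) + (v m - v n).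
  by rewrite scalerBr addrACA -opprD.
apply: le_lt_trans (ler_anormD pN _ _) _; rewrite [ltRHS]splitr.
apply: ltrD; last exact: h2.
rewrite anormZ //; have := h1 m n m1 n1; rewrite ltr_pdivlMr // => /le_lt_trans.
by apply; rewrite mulrC ler_wpM2l ?anorm_ge0 // lerDl.
Qed.

End CauchySequences.

(** * Completion of a normed algebra *)

Section Completion.
Variables (R : realType) (A : assocAlgType R[i]) (p : A -> R).
Hypothesis pN : algebra_norm p.

(** The proof of [algebra_norm p] is an argument, so that the submodule instance relying on it can
    be inferred from the predicate. *)
Definition cauchy_pred of algebra_norm p : {pred nat -> A} :=
  fun u => `[< cauchy_for p u >].

Fact cauchy_pred_submod : submod_closed (cauchy_pred pN).
Proof.
split=> [|k u v /asboolP uC /asboolP vC]; apply/asboolP.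
  exact: cauchy_for_cst.
exact: cauchy_for_lin.
Qed.

HB.instance Definition _ :=
  GRing.isSubmodClosed.Build R[i] (nat -> A) (cauchy_pred pN) cauchy_pred_submod.

Record cauchy_seq :=
  CauchySeq {cauchy_seq_val :> nat -> A; _ : cauchy_seq_val \in cauchy_pred pN}.

HB.instance Definition _ := [isSub for cauchy_seq_val].
HB.instance Definition _ := [Choice of cauchy_seq by <:].
HB.instance Definition _ := [SubChoice_isSubLmodule of cauchy_seq by <:].

Implicit Types (u v w : cauchy_seq).

Lemma cauchy_seqP u : cauchy_for p u.
Proof. by case: u => u uC; exact/asboolP. Qed.

Definition null_seq : {pred cauchy_seq} := fun u => `[< cvg_for p u 0 >].

Lemma null_seqP u : reflect (p (u n) @[n --> \oo] --> (0 : R)) (u \in null_seq).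
Proof.
have E : (fun n => p (u n - 0)) = (fun n => p (u n)).
  by apply/funext => n; rewrite subr0.
by apply: (iffP (asboolP _)); rewrite -E => u0; apply/(cvg_for_cvgn pN).
Qed.

Lemma null_seq_dominated (f : nat -> R) u : f @ \oo --> (0 : R) ->
  (\forall n \near \oo, p (u n) <= f n) -> u \in null_seq.
Proof.
move=> f0 uf; apply/null_seqP; apply: (squeeze_cvgr _ (cvg_cst 0) f0).
by near=> n; rewrite anorm_ge0 //=; near: n.
Unshelve. all: by end_near. Qed.

Fact null_seq_zmod : zmod_closed null_seq.
Proof.
split=> [|u v /null_seqP u0 /null_seqP v0].
  apply/null_seqP; have -> : (fun n => p ((0 : cauchy_seq) n)) = cst 0.
    by apply/funext => n; exact: anorm0.
  exact: cvg_cst.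
apply: (null_seq_dominated (f := fun n => p (u n) + p (v n))).
  by rewrite -[0]addr0; apply: cvgD.
by near=> n; exact: ler_anormB.
Unshelve. all: by end_near. Qed.

HB.instance Definition _ := GRing.isZmodClosed.Build cauchy_seq null_seq
  null_seq_zmod.

(** The quotient supplies the additive group only. Scaling and product are defined below on
    representatives; they are well defined because null sequences absorb scalars and Cauchy
    factors. *)
Definition completion := Quotient.quot null_seq.
HB.instance Definition _ := GRing.Zmodule.on completion.

Definition completion_class u : completion := \pi_completion%qT u.

Local Notation "[~ u ]" := (completion_class u) (format "[~  u ]").

Lemma completion_eqP u v : u - v \in null_seq <-> [~ u] = [~ v].
Proof. by rewrite Quotient.idealrBE; split=> [/eqP|/eqP]. Qed.

Lemma completionD u v : [~ u + v] = [~ u] + [~ v].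
Proof. exact: raddfD. Qed.

Lemma completionB u v : [~ u - v] = [~ u] - [~ v].
Proof. exact: raddfB. Qed.

Lemma completionP (x : completion) : exists u, x = [~ u].
Proof. by exists (repr x); rewrite /completion_class reprK. Qed.

Lemma null_seq_repr u : repr [~ u] - u \in null_seq.
Proof. by apply/completion_eqP; rewrite /completion_class reprK. Qed.

Definition cauchy_mul u v : cauchy_seq :=
  CauchySeq (asboolT (cauchy_forM pN (cauchy_seqP u) (cauchy_seqP v))).

Lemma null_seqZ k u : u \in null_seq -> k *: u \in null_seq.
Proof.
move=> /null_seqP u0.
apply: (null_seq_dominated (f := fun n => normc k * p (u n))).
  by rewrite -(mulr0 (normc k)); apply: cvgMr.
by near=> n; rewrite -anormZ.
Unshelve. all: by end_near. Qed.

Lemma null_seqMl u v : u \in null_seq -> cauchy_mul u v \in null_seq.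
Proof.
move=> /null_seqP u0; have [M M0 vM] := cauchy_for_bounded pN (cauchy_seqP v).
apply: (null_seq_dominated (f := fun n => p (u n) * M)).
  by rewrite -(mul0r M); apply: cvgMl.
near=> n; apply: le_trans (ler_anormM pN _ _) _.
by rewrite ler_wpM2l ?anorm_ge0 //; near: n.
Unshelve. all: by end_near. Qed.

Lemma null_seqMr u v : v \in null_seq -> cauchy_mul u v \in null_seq.
Proof.
move=> /null_seqP v0; have [M M0 uM] := cauchy_for_bounded pN (cauchy_seqP u).
apply: (null_seq_dominated (f := fun n => M * p (v n))).
  by rewrite -(mulr0 M); apply: cvgMr.
near=> n; apply: le_trans (ler_anormM pN _ _) _.
by rewrite ler_wpM2r ?anorm_ge0 //; near: n.
Unshelve. all: by end_near. Qed.

Definition completion_scale k (x : completion) : completion := [~ k *: repr x].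

Definition completion_mul (x y : completion) : completion :=
  [~ cauchy_mul (repr x) (repr y)].

Lemma completion_scaleE k u : completion_scale k [~ u] = [~ k *: u].
Proof.
by apply/completion_eqP; rewrite -scalerBr null_seqZ // null_seq_repr.
Qed.

Lemma cauchy_mulBl u v w :
  cauchy_mul u w - cauchy_mul v w = cauchy_mul (u - v) w.
Proof. by apply/val_inj/funext => n; rewrite [RHS]amulBl. Qed.

Lemma cauchy_mulBr u v w :
  cauchy_mul u v - cauchy_mul u w = cauchy_mul u (v - w).
Proof. by apply/val_inj/funext => n; rewrite [RHS]amulBr. Qed.

Lemma completion_mulE u v :
  completion_mul [~ u] [~ v] = [~ cauchy_mul u v].
Proof.
transitivity [~ cauchy_mul (repr [~ u]) v].
  by apply/completion_eqP; rewrite cauchy_mulBr null_seqMr // null_seq_repr.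
by apply/completion_eqP; rewrite cauchy_mulBl null_seqMl // null_seq_repr.
Qed.

Fact completion_scalerA a b x :
  completion_scale a (completion_scale b x) = completion_scale (a * b) x.
Proof. by have [u ->] := completionP x; rewrite !completion_scaleE scalerA. Qed.

Fact completion_scale1r : left_id 1 completion_scale.
Proof.
by move=> x; have [u ->] := completionP x; rewrite completion_scaleE scale1r.
Qed.

Fact completion_scalerDr : right_distributive completion_scale +%R.
Proof.
move=> k x y; have [u ->] := completionP x; have [v ->] := completionP y.
by rewrite -completionD !completion_scaleE scalerDr completionD.
Qed.

Fact completion_scalerDl x : {morph completion_scale^~ x : a b / a + b}.
Proof.
move=> a b; have [u ->] := completionP x.
by rewrite !completion_scaleE scalerDl completionD.
Qed.

HB.instance Definition _ := GRing.Zmodule_isLmodule.Build R[i] completion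
  completion_scalerA completion_scale1r completion_scalerDr completion_scalerDl.

Fact completion_mulA : associative completion_mul.
Proof.
move=> x y z; have [u ->] := completionP x; have [v ->] := completionP y.
have [w ->] := completionP z; rewrite !completion_mulE; congr [~ _].
by apply/val_inj/funext => n; rewrite /= amulA.
Qed.

Fact completion_mulDl : left_distributive completion_mul +%R.
Proof.
move=> x y z; have [u ->] := completionP x; have [v ->] := completionP y.
have [w ->] := completionP z; rewrite -completionD !completion_mulE -completionD.
by congr [~ _]; apply/val_inj/funext => n; rewrite /= amulDl.
Qed.

Fact completion_mulDr : right_distributive completion_mul +%R.
Proof.
move=> x y z; have [u ->] := completionP x; have [v ->] := completionP y.
have [w ->] := completionP z; rewrite -completionD !completion_mulE -completionD.
by congr [~ _]; apply/val_inj/funext => n; rewrite /= amulDr.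
Qed.

Fact completion_mulZl k (x y : completion) :
  completion_mul (k *: x) y = k *: completion_mul x y.
Proof.
have [u ->] := completionP x; have [v ->] := completionP y.
rewrite -[k *: [~ u]]/(completion_scale k _) completion_scaleE !completion_mulE.
rewrite -[RHS]/(completion_scale k _) completion_scaleE; congr [~ _].
by apply/val_inj/funext => n; rewrite /= amulZl.
Qed.

Fact completion_mulZr k (x y : completion) :
  completion_mul x (k *: y) = k *: completion_mul x y.
Proof.
have [u ->] := completionP x; have [v ->] := completionP y.
rewrite -[k *: [~ v]]/(completion_scale k _) completion_scaleE !completion_mulE.
rewrite -[RHS]/(completion_scale k _) completion_scaleE; congr [~ _].
by apply/val_inj/funext => n; rewrite /= amulZr.
Qed.

HB.instance Definition _ := Lmodule_isAssocAlgebra.Build R[i] completion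
  completion_mulA completion_mulDl completion_mulDr
  completion_mulZl completion_mulZr.

Lemma completionZ k u : [~ k *: u] = k *: [~ u].
Proof. by rewrite -completion_scaleE. Qed.

Lemma completionM u v : [~ cauchy_mul u v] = [~ u] *a [~ v].
Proof. by rewrite -completion_mulE. Qed.

Definition completion_norm (x : completion) : R :=
  lim (p (repr x n) @[n --> \oo]).

(** Independence of the representative: p(w n) and p(u n) differ by at most p((w - u) n), which
    tends to 0. *)
Lemma cvg_completion_norm u : p (u n) @[n --> \oo] --> completion_norm [~ u].
Proof.
have /null_seqP w0 := null_seq_repr u; set w := repr _ in w0 *.
have wC : p (w n) @[n --> \oo] --> completion_norm [~ u].
  rewrite /completion_norm -/w; exact: (cauchy_for_cvg_anorm pN (cauchy_seqP w)).
apply: (@squeeze_cvgr _ _ _ _ (fun n => p (w n) - p ((w - u) n))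
                     (fun n => p (w n) + p ((w - u) n))).
- near=> n; rewrite lerBlDr -{1}[w n](subrK (u n)) addrC ler_anormD //=.
  rewrite -{1}[u n](subKr (w n)); exact: ler_anormB.
- by rewrite -[completion_norm _]subr0; apply: cvgB.
- by rewrite -[completion_norm _]addr0; apply: cvgD.
Unshelve. all: by end_near. Qed.

Lemma completion_norm_lim u (l : R) :
  p (u n) @[n --> \oo] --> l -> completion_norm [~ u] = l.
Proof. by move=> ul; apply: (norm_cvg_unique (@cvg_completion_norm u) ul). Qed.

Lemma completion_norm_le u (e : R) :
  (\forall n \near \oo, p (u n) <= e) -> completion_norm [~ u] <= e.
Proof.
by move=> ue; apply: (ler_cvg_to (@cvg_completion_norm u) (@cvg_cst R e nat _ _)).
Qed.

Lemma completion_norm_algebra_norm : algebra_norm completion_norm.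
Proof.
split.
- move=> x; have [u ->] := completionP x.
  apply: limr_ge; first exact: cvgP (@cvg_completion_norm _).
  by near=> n; exact: anorm_ge0.
- move=> x; have [u ->] := completionP x => u0.
  have := @cvg_completion_norm u; rewrite u0 => /null_seqP.
  by rewrite -{1}[u]subr0 => /completion_eqP ->; rewrite -(subrr u) completionB subrr.
- move=> x y; have [u ->] := completionP x; have [v ->] := completionP y.
  rewrite -completionD; apply: ler_cvg_to (@cvg_completion_norm _) _ _.
    by apply: cvgD; exact: cvg_completion_norm.
  by near=> n; exact: ler_anormD.
- move=> k x; have [u ->] := completionP x; rewrite -completionZ.
  apply: completion_norm_lim.
  have -> : (fun n => p ((k *: u) n)) = (fun n => normc k * p (u n)).
    by apply/funext => n; rewrite -anormZ.
  by apply: cvgMr; exact: cvg_completion_norm.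
- move=> x y; have [u ->] := completionP x; have [v ->] := completionP y.
  rewrite -completionM; apply: ler_cvg_to (@cvg_completion_norm _) _ _.
    by apply: cvgM; exact: cvg_completion_norm.
  by near=> n; exact: ler_anormM.
Unshelve. all: by end_near. Qed.

Definition to_completion a : completion :=
  [~ CauchySeq (asboolT (cauchy_for_cst pN a))].

Fact to_completion_is_linear : linear to_completion.
Proof.
move=> k a b; rewrite /to_completion -completionZ -completionD.
by congr [~ _]; apply/val_inj/funext.
Qed.

HB.instance Definition _ := GRing.isLinear.Build R[i] A completion _
  to_completion to_completion_is_linear.

Lemma to_completionM a b :
  to_completion (a *a b) = to_completion a *a to_completion b.
Proof. by rewrite -completionM; congr [~ _]; apply/val_inj/funext. Qed.

Lemma completion_norm_to a : completion_norm (to_completion a) = p a.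
Proof. by apply: completion_norm_lim; apply: (@cvg_cst R (p a) nat). Qed.

Lemma to_completion_dense x (e : R) : 0 < e ->
  exists a, completion_norm (x - to_completion a) <= e.
Proof.
move=> e0; have [u ->] := completionP x; have [N uN] := cauchy_seqP u e0.
exists (u N); rewrite -completionB.
have uN' : \forall n \near \oo, p (u n - u N) <= e.
  by exists N => // n /= Nn; rewrite ltW // uN.
exact: completion_norm_le.
Qed.

(** Approximate the n-th term within 1/(n+1) by an element [v n] of A. The sequence [v] is Cauchy
    for [p], and its class is the limit. *)
Fact completion_norm_complete : complete_for completion_norm.
Proof.
have qN := completion_norm_algebra_norm; set q := completion_norm in qN *.
have eps0 n : 0 < n.+1%:R^-1 :> R by rewrite invr_gt0 ltr0n.
move=> x xC.
have /choice[v xv] n := to_completion_dense (x n) (eps0 n).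
have epsP (e : R) : 0 < e -> exists N, forall n, (N <= n)%N -> n.+1%:R^-1 < e.
  move=> e0; have [N _ hN] := near_infty_natSinv_lt (PosNum e0).
  by exists N => n Nn; exact: hN n Nn.
have vC : cauchy_for p v.
  move=> e e0; have e3 : 0 < e / 3 by rewrite divr_gt0.
  have [N1 h1] := xC _ e3; have [N2 h2] := epsP _ e3.
  exists (maxn N1 N2) => m n; rewrite !geq_max => /andP[m1 m2] /andP[n1 n2].
  rewrite -completion_norm_to linearB /=.
  have -> : e = e / 3 + (e / 3 + e / 3) by field.
  apply: le_lt_trans (ler_anorm_dist qN _ (x m) _) _; apply: ler_ltD.
    by rewrite (anormC qN) (le_trans (xv m)) // ltW // h2.
  apply: le_lt_trans (ler_anorm_dist qN _ (x n) _) _; apply: ltr_leD.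
    exact: h1.
  by rewrite (le_trans (xv n)) // ltW // h2.
exists [~ CauchySeq (asboolT vC)] => e e0; have e2 : 0 < e / 2 by rewrite divr_gt0.
have [N1 h1] := epsP _ e2; have [N2 h2] := vC _ e2.
exists (maxn N1 N2) => n; rewrite geq_max => /andP[n1 n2].
apply: le_lt_trans (ler_anorm_dist qN _ (to_completion (v n)) _) _.
rewrite [ltRHS]splitr; apply: ltr_leD.
  by rewrite (le_lt_trans (xv n)) // h1.
rewrite -completionB.
have vn : \forall m \near \oo, p (v n - v m) <= e / 2.
  by exists N2 => // m /= m2; rewrite ltW // h2.
exact: completion_norm_le.
Qed.

HB.instance Definition _ := AssocAlgebra_isBanach.Build R completion
  completion_norm_algebra_norm completion_norm_complete.

End Completion.

(** Makes every norm on A the restriction of the norm of a super Banach algebra, where SEP can be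
    applied. *)
Lemma algebra_norm_completion (R : realType) (A : assocAlgType R[i]) (p : A -> R) :
  algebra_norm p -> exists (B : banachAlgType R) (f : {linear A -> B}),
    algebra_embedding f /\ forall a, bnorm (f a) = p a.
Proof.
move=> pN; exists (completion pN), (to_completion pN).
split; last exact: completion_norm_to.
split; last exact: to_completionM.
move=> a b ab; apply/eqP; rewrite -subr_eq0; apply/eqP/(anorm_eq0 pN).
rewrite -(completion_norm_to pN) linearB /= ab subrr.
exact: anorm0 (completion_norm_algebra_norm pN).
Qed.

(** With B the completion of A for [p]: |k| <= r_A(a) = r_B(a) <= p(a). *)
Lemma SEP_spectrum_le (R : realType) (A : banachAlgType R) (p : A -> R) a k :
  SEP A -> algebra_norm p -> spectrum a k -> normc k <= p a.
Proof.
move=> sepA /algebra_norm_completion[B [f [fP fp]]] /spectrum_radius.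
move/le_trans; apply; rewrite (sepA _ _ fP) -fp.
exact: spectral_radius_bnorm.
Qed.

(** * The Jacobson radical and faithfulness of the unitization *)

Section RadicalTheory.
Variables (K : fieldType) (A : assocAlgType K).

(** If L is not inside a maximal modular left ideal M with right modular unit u, then M + L is
    everything and u = m + y with m in M and y in L. For a quasi-inverse z of y, y = z - z y = (z -
    z u) + z m lies in M; so does u, and M is the whole algebra. *)
Lemma quasi_invertible_ideal_radical (L : set A) : left_ideal L ->
  (forall x, L x -> quasi_invertible x) -> L `<=` @jacobson_radical K A.
Proof.
move=> [L0 LD LZ LM] Lq x Lx M [[[M0 MD MZ MM] [u uM]] MT maxM].
apply: contrapT => Mx.
have [||NM|NT] := maxM [set m + y | m in M & y in L].
- split; first by exists 0 => //; exists 0; rewrite ?addr0.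
  + move=> _ _ [m Mm [y Ly <-]] [m' Mm' [y' Ly' <-]].
    by exists (m + m'); [exact: MD|exists (y + y'); [exact: LD|rewrite addrACA]].
  + move=> k _ [m Mm [y Ly <-]].
    by exists (k *: m); [exact: MZ|exists (k *: y); [exact: LZ|rewrite scalerDr]].
  + move=> a _ [m Mm [y Ly <-]].
    by exists (a *a m); [exact: MM|exists (a *a y); [exact: LM|rewrite amulDr]].
- by move=> m Mm; exists m => //; exists 0; rewrite ?addr0.
- by apply: Mx; rewrite -NM; exists 0 => //; exists x; rewrite ?add0r.
have [m Mm [y Ly my]] : [set m + y | m in M & y in L] u by rewrite NT.
have [z [_ zE]] := Lq _ Ly.
have Mu : M u.
  have yE : (z - z *a u) + z *a m = y.
    by rewrite -my amulDr opprD !addrA addrAC subrK {1}zE addrK.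
  rewrite -my -yE.
  by apply: (MD _ _ Mm); apply: MD; [exact: uM|exact: MM].
apply: MT; apply/seteqP; split=> // a _.
by rewrite -(subrK (a *a u) a); apply: MD; [exact: uM|exact: MM].
Qed.

Hypothesis A_semisimple : semisimple A.

Lemma semisimple_quasi_invertible_ideal (L : set A) x : left_ideal L ->
  (forall y, L y -> quasi_invertible y) -> L x -> x = 0.
Proof.
move=> LI Lq Lx; have := quasi_invertible_ideal_radical LI Lq Lx.
by move: A_semisimple; rewrite /semisimple => ->.
Qed.

(** The left annihilators of A form a left ideal whose elements square to zero, and such an element
    is its own quasi-inverse. *)
Lemma semisimple_left_annihilator (a : A) : (forall x, a *a x = 0) -> a = 0.
Proof.
pose L : set A := [set b | forall x, b *a x = 0]; move=> a0.
have LI : left_ideal L.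
  split=> /=.
  - exact: amul0x.
  - by move=> x y x0 y0 z; rewrite amulDl x0 y0 addr0.
  - by move=> k x x0 z; rewrite amulZl x0 scaler0.
  - by move=> b x x0 z; rewrite -amulA x0 amulx0.
have Lq y : L y -> quasi_invertible y by move=> y0; exists y; rewrite y0 addr0.
exact: semisimple_quasi_invertible_ideal LI Lq a0.
Qed.

Hypothesis A_nonunital : ~ has_identity A.

(** If a + k acts as zero and k is nonzero, then e = - a / k is a left identity. Every y - y e then
    annihilates A from the left, hence vanishes, and e would be an identity of A. *)
Lemma unitization_faithful (x : unitization A) :
  (forall y, x.1 *a y + (x.2 : K) *: y = 0) -> x = 0.
Proof.
move=> x0; have [k0|k0] := eqVneq (x.2 : K) 0.
  have : x.1 = 0.
    apply: semisimple_left_annihilator => y.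
    by have := x0 y; rewrite k0 scale0r addr0.
  by move: k0; case: {x0}x => a k /= -> ->.
case: A_nonunital; exists (- (x.2 : K)^-1 *: x.1).
have eL y : (- (x.2 : K)^-1 *: x.1) *a y = y.
  have /eqP := x0 y; rewrite addr_eq0 => /eqP xy.
  by rewrite amulZl xy scaleNr scalerN opprK scalerA mulVf // scale1r.
move=> y; split=> //; apply/eqP; rewrite -subr_eq0; apply/eqP.
by apply: semisimple_left_annihilator => z; rewrite amulBl -amulA eL subrr.
Qed.

End RadicalTheory.

(** * The operator norm on the unitization *)

Section OperatorNorm.
Variables (R : realType) (A : assocAlgType R[i]) (p : A -> R).
Hypothesis pN : algebra_norm p.
Local Notation Ae := (unitization A).
Implicit Types (x y : Ae) (a b : A).

(** The left regular representation of the unitization on its ideal A. *)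
Definition uact x a : A := x.1 *a a + (x.2 : R[i]) *: a.

(** Reduces the laws of the action to ring identities in the unitization. *)
Lemma to_unitization_uact x a :
  to_unitization (uact x a) = x * to_unitization a.
Proof. by congr pair; rewrite /= ?mulr0 // scale0r addr0. Qed.

Lemma uactM x y a : uact (x * y) a = uact x (uact y a).
Proof. by apply: to_unitization_inj; rewrite !to_unitization_uact mulrA. Qed.

Lemma uactD x y a : uact (x + y) a = uact x a + uact y a.
Proof.
apply: to_unitization_inj.
by rewrite to_unitizationD !to_unitization_uact mulrDl.
Qed.

Lemma uactZ k x a : uact (k *: x) a = k *: uact x a.
Proof.
apply: to_unitization_inj.
by rewrite to_unitizationZ !to_unitization_uact scalerAl.
Qed.

Lemma uact_scaler k x a : uact x (k *: a) = k *: uact x a.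
Proof.
apply: to_unitization_inj.
by rewrite to_unitizationZ !to_unitization_uact to_unitizationZ -scalerAr.
Qed.

Lemma uact_to_unitization a b : uact (to_unitization a) b = a *a b.
Proof. by rewrite /uact scale0r addr0. Qed.

Lemma uact1 a : uact 1 a = a.
Proof. by rewrite /uact amul0x scale1r add0r. Qed.

Lemma ler_uact x a : p (uact x a) <= ell1_norm p x * p a.
Proof.
apply: le_trans (ler_anormD pN _ _) _; rewrite anormZ // mulrDl.
by rewrite lerD2r ler_anormM.
Qed.

Lemma has_ubound_uact x :
  has_ubound [set p (uact x y) | y in [set y | p y <= 1]].
Proof.
exists (ell1_norm p x) => _ [a /= a1 <-]; apply: le_trans (ler_uact _ _) _.
by rewrite -[leRHS]mulr1 ler_wpM2l // addr_ge0 ?anorm_ge0 ?normc_ge0.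
Qed.

Lemma op_norm_le x (M : R) : 0 <= M ->
  (forall a, p (uact x a) <= M * p a) -> op_norm p x <= M.
Proof.
move=> M0 xM; apply: ge_sup.
  by exists (p (uact x 0)); exists 0 => //=; rewrite anorm0.
move=> _ [a /= a1 <-]; apply: le_trans (xM a) _.
by rewrite -[leRHS]mulr1 ler_wpM2l.
Qed.

Lemma normc_real (r : R) : normc r%:C%C = `|r|.
Proof. by rewrite /= expr0n addr0 sqrtr_sqr. Qed.

Lemma op_normP x a : p (uact x a) <= op_norm p x * p a.
Proof.
have [->|a0] := pselect (a = 0).
  by rewrite /uact amulx0 scaler0 addr0 !anorm0 // mulr0.
have pa := anorm_gt0 pN a0; rewrite -ler_pdivrMr //.
have E : (p a)^-1 * p a = 1 by rewrite mulVf // gt_eqF.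
have pi : 0 <= (p a)^-1 by rewrite invr_ge0 ltW.
apply: (ub_le_sup (has_ubound_uact x)); exists ((p a)^-1%:C%C *: a) => /=.
  by rewrite anormZ // normc_real ger0_norm // E.
by rewrite -/(uact _ _) uact_scaler anormZ // normc_real ger0_norm // mulrC.
Qed.

Lemma op_norm_ge0 x : 0 <= op_norm p x.
Proof.
apply: (ub_le_sup (has_ubound_uact x)); exists 0 => /=; first by rewrite anorm0.
by rewrite /uact amulx0 scaler0 addr0 anorm0.
Qed.

Lemma op_norm_le_ell1 x : op_norm p x <= ell1_norm p x.
Proof.
apply: op_norm_le => [|a]; last exact: ler_uact.
by rewrite addr_ge0 ?anorm_ge0 ?normc_ge0.
Qed.

Lemma op_norm1 : op_norm p 1 <= 1.
Proof. by apply: op_norm_le => // a; rewrite uact1 mul1r. Qed.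

(** Definiteness is the faithfulness of the action on A, which uses semisimplicity and the absence
    of an identity. *)
Lemma op_norm_algebra_norm : semisimple A -> ~ has_identity A ->
  algebra_norm (op_norm p).
Proof.
move=> ss nu; split.
- exact: op_norm_ge0.
- move=> x x0; apply: (unitization_faithful ss nu) => a.
  apply: (anorm_eq0 pN); apply/eqP; rewrite eq_le anorm_ge0 // andbT.
  by rewrite -(mul0r (p a)) -x0; exact: op_normP.
- move=> x y; apply: op_norm_le => [|a]; first by rewrite addr_ge0 ?op_norm_ge0.
  rewrite uactD mulrDl; apply: le_trans (ler_anormD pN _ _) _.
  by rewrite lerD ?op_normP.
(* The reverse inequality is this one applied to [k^-1] and [k *: x]. *)
- have le k x : op_norm p (k *: x) <= normc k * op_norm p x.
    apply: op_norm_le => [|a]; first by rewrite mulr_ge0 ?normc_ge0 ?op_norm_ge0.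
    by rewrite uactZ anormZ // -mulrA ler_wpM2l ?normc_ge0 ?op_normP.
  move=> k x; apply/eqP; rewrite eq_le le /=.
  have [->|k0] := eqVneq k 0; first by rewrite normc0 mul0r op_norm_ge0.
  have := le k^-1 (k *: x); rewrite scalerA mulVf // scale1r normcV //.
  rewrite mulrC ler_pdivlMr; first by rewrite mulrC.
  by rewrite lt_def normc_ge0 andbT; apply: contraNneq k0 => /eq0_normc ->.
- move=> x y; apply: op_norm_le => [|a]; first by rewrite mulr_ge0 ?op_norm_ge0.
  rewrite amul_unitization uactM -mulrA; apply: le_trans (op_normP _ _) _.
  by rewrite ler_wpM2l ?op_norm_ge0 ?op_normP.
Qed.

End OperatorNorm.

Lemma algebra_norm_restrict (R : realType) (A : assocAlgType R[i])
    (q : unitization A -> R) : algebra_norm q ->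
  algebra_norm (fun a => q (to_unitization a)).
Proof.
move=> qN; split.
- by move=> a; exact: anorm_ge0.
- by move=> a /(anorm_eq0 qN) /to_unitization_inj.
- by move=> a b; rewrite to_unitizationD ler_anormD.
- by move=> k a; rewrite to_unitizationZ anormZ.
- by move=> a b; rewrite to_unitizationM; exact: ler_anormM.
Qed.

Lemma op_norm_le_norm (R : realType) (A : assocAlgType R[i])
    (q : unitization A -> R) : algebra_norm q ->
  forall x, op_norm (fun a => q (to_unitization a)) x <= q x.
Proof.
move=> qN x; apply: (op_norm_le (algebra_norm_restrict qN)) => [|a].
  exact: anorm_ge0.
by rewrite to_unitization_uact; exact: ler_anormM.
Qed.

(** * Inequalities between infima *)

Section Infima.
Variable R : realType.
Implicit Types (S T : set R) (c s : R).

Lemma ler_addr_inf S s c : S !=set0 -> (forall a, S a -> c <= s + a) ->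
  c <= s + inf S.
Proof.
move=> S0 cS; rewrite -lerBlDl; apply: lb_le_inf => // a Sa.
by rewrite lerBlDl cS.
Qed.

Lemma ler_inf_add S T c : S !=set0 -> T !=set0 ->
  (forall a b, S a -> T b -> c <= a + b) -> c <= inf S + inf T.
Proof.
move=> S0 T0 cST; apply: ler_addr_inf => // b Tb; rewrite addrC.
by apply: ler_addr_inf => // a Sa; rewrite addrC cST.
Qed.

Lemma ler_mulr_inf S s c : 0 <= s -> S !=set0 ->
  (forall a, S a -> c <= s * a) -> c <= s * inf S.
Proof.
rewrite le_eqVlt => /predU1P[<-|s0] S0 cS.
  by case: S0 => a /cS; rewrite !mul0r.
rewrite mulrC -ler_pdivrMr //; apply: lb_le_inf => // a Sa.
by rewrite ler_pdivrMr // mulrC cS.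
Qed.

Lemma ler_inf_mul S T c : S !=set0 -> T !=set0 -> lbound S 0 -> lbound T 0 ->
  (forall a b, S a -> T b -> c <= a * b) -> c <= inf S * inf T.
Proof.
move=> S0 T0 Sp Tp cST; apply: ler_mulr_inf => // [|b Tb].
  exact: lb_le_inf.
by rewrite mulrC; apply: ler_mulr_inf => // [|a Sa];
  [exact: Tp|rewrite mulrC cST].
Qed.

End Infima.

(** * Minimal functions by Zorn's lemma *)

Section MinimalFunctions.
Variables (R : realType) (T : Type).
Implicit Types (f g : T -> R) (P C : set (T -> R)).

Definition ptwise_inf C x : R := inf [set f x | f in C].

Definition ptwise_le f g : Prop := forall x, f x <= g x.

Lemma ptwise_inf_le P C f : C `<=` P ->
  (forall x, has_lbound [set f x | f in P]) -> C f -> ptwise_le (ptwise_inf C) f.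
Proof.
move=> CP Pl Cf x; apply: ge_inf; last by exists f.
have [b bl] := Pl x; exists b => _ [g Cg <-]; apply: bl; exists g => //.
exact: CP.
Qed.

(** Zorn's lemma for the members of [P] below [p], with the pointwise order reversed; a chain is
    bounded by its pointwise infimum. It serves both the Hahn-Banach theorem and the existence of
    minimal norms. *)
Lemma exists_minimal_function P p :
  (forall x, has_lbound [set f x | f in P]) ->
  (forall C, C !=set0 -> C `<=` P -> total_on C ptwise_le -> P (ptwise_inf C)) ->
  P p -> exists q, [/\ P q, ptwise_le q p
                     & forall f, P f -> ptwise_le f q -> f = q].
Proof.
move=> Pl Pinf Pp; pose U := {f | P f /\ ptwise_le f p}.
pose r (f g : U) := `[< ptwise_le (sval g) (sval f) >].
have rP (f g : U) : reflect (ptwise_le (sval g) (sval f)) (r f g) by exact: asboolP.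
have up : P p /\ ptwise_le p p by split=> // x.
have [|||C Ctot|[q [Pq qp]] qmax] := @Zorn U r.
- by move=> f; apply/rP.
- by move=> f g h /rP fg /rP gh; apply/rP => x; exact: le_trans (gh x) (fg x).
- move=> f g /rP fg /rP gf; case: f g fg gf => [f Pf] [g Pg] /= fg gf.
  apply: eq_exist.
  by apply/funext => x; apply/eqP; rewrite eq_le fg gf.
(* The empty chain has no useful infimum and is bounded by [p] itself. *)
- have [[f Cf]|C0] := pselect (C !=set0); last first.
    by exists (exist _ p up) => f Cf; case: C0; exists f.
  pose D := [set sval f | f in C].
  have DP : D `<=` P by move=> _ [[g [Pg ?]] _ <-].
  have Df : D (sval f) by exists f.
  have Dtot : total_on D ptwise_le.
    by move=> _ _ [g Cg <-] [h Ch <-]; have [/rP|/rP] := Ctot g h Cg Ch; [right|left].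
  have iP : P (ptwise_inf D) /\ ptwise_le (ptwise_inf D) p.
    split; first by apply: Pinf => //; exists (sval f).
    move=> x; apply: le_trans (ptwise_inf_le DP Pl Df x) _.
    by case: (svalP f) => _; exact.
  exists (exist _ (ptwise_inf D) iP : U) => g Cg; apply/rP => /=.
  by apply: (ptwise_inf_le DP Pl); exists g.
exists q; split=> // f Pf fq.
have fp : P f /\ ptwise_le f p by split=> // x; exact: le_trans (fq x) (qp x).
by have /(congr1 sval) := qmax (exist _ f fp) (introT (rP (exist _ q _) (exist _ f fp)) fq).
Qed.

(** Lets an inequality involving two members of a chain be checked on a single member below both. *)
Lemma total_ptwise_le C f g : total_on C ptwise_le -> C f -> C g ->
  exists2 h, C h & ptwise_le h f /\ ptwise_le h g.
Proof.
move=> Ct Cf Cg; have [fg|gf] := Ct f g Cf Cg.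
  by exists f => //; split=> // x.
by exists g => //; split=> // x.
Qed.

End MinimalFunctions.

(** * The Hahn-Banach theorem, real and complex *)

Section HahnBanach.
Variables (R : realType) (V : lmodType R[i]).
Implicit Types (p q : V -> R) (x y : V).

(** Homogeneity is asked only as an inequality, which is easier to check for infima; inverting t
    turns it into an equality. *)
Definition sublinear q := (forall x y, q (x + y) <= q x + q y) /\
  (forall (t : R) x, 0 <= t -> q (t%:C%C *: x) <= t * q x).

Lemma sublinearZ q (t : R) x : sublinear q -> 0 <= t ->
  q (t%:C%C *: x) = t * q x.
Proof.
move=> [qD qZ] t0; apply/eqP; rewrite eq_le qZ //=.
move: (t0); rewrite [0 <= t]le_eqVlt => /predU1P[<-|tp].
  by rewrite mul0r scale0r; have := qD 0 0; rewrite addr0 lerDl.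
have ti : 0 <= t^-1 by rewrite invr_ge0.
have := qZ t^-1 (t%:C%C *: x) ti; rewrite scalerA -rmorphM mulVf ?gt_eqF //.
by rewrite rmorph1 scale1r mulrC ler_pdivlMr // mulrC.
Qed.

Lemma sublinear0 q : sublinear q -> q 0 = 0.
Proof.
by move=> qS; rewrite -(scale0r 0) -(rmorph0 (real_complex R)) sublinearZ ?mul0r.
Qed.

Lemma sublinearN q x : sublinear q -> - q (- x) <= q x.
Proof.
move=> qS; have [qD _] := qS; have := qD x (- x).
by rewrite subrr sublinear0 // -lerBlDr sub0r.
Qed.

(** For sublinear q, this is the largest sublinear functional below q whose value at - y is at most
    - q(y). *)
Definition sublinear_shift q y x :=
  inf [set q (x + t%:C%C *: y) - t * q y | t in [set t : R | 0 <= t]].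

Section Shift.
Variables (q : V -> R) (y : V).
Hypothesis qS : sublinear q.

Let S x := [set q (x + t%:C%C *: y) - t * q y | t in [set t : R | 0 <= t]].

Let S0 x : S x !=set0.
Proof. by exists (q (x + 0%:C%C *: y) - 0 * q y); exists 0 => /=. Qed.

Let S_lb x : has_lbound (S x).
Proof.
exists (- q (- x)) => _ [t /= t0 <-]; have [qD _] := qS.
rewrite lerBrDr addrC lerBlDr; have := qD (x + t%:C%C *: y) (- x).
by rewrite addrAC subrr add0r sublinearZ.
Qed.

Lemma sublinear_shift_le x (t : R) : 0 <= t ->
  sublinear_shift q y x <= q (x + t%:C%C *: y) - t * q y.
Proof. by move=> t0; apply: (ge_inf (S_lb x)); exists t. Qed.

Lemma sublinear_shift_sublinear : sublinear (sublinear_shift q y).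
Proof.
have [qD qZ] := qS; split=> [x x'|s x s0].
  apply: (ler_inf_add (S0 x) (S0 x')) => _ _ [t /= t0 <-] [t' /= t0' <-].
  apply: le_trans (sublinear_shift_le _ (addr_ge0 t0 t0')) _.
  rewrite addrACA -opprD -mulrDl lerD2r; apply: le_trans (qD _ _).
  by rewrite rmorphD scalerDl addrACA.
apply: (ler_mulr_inf s0 (S0 x)) => _ [t /= t0 <-].
apply: le_trans (sublinear_shift_le _ (mulr_ge0 s0 t0)) _.
by rewrite mulrBr -mulrA lerD2r rmorphM -scalerA -scalerDr qZ.
Qed.

End Shift.

(* A minimal sublinear functional is unchanged by every shift, which makes it additive. *)
Lemma hahn_banach_real p y : sublinear p -> exists q,
  [/\ forall x x', q (x + x') = q x + q x',
      forall (t : R) x, 0 <= t -> q (t%:C%C *: x) = t * q x,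
      forall x, q x <= p x & q y = p y].
Proof.
move=> pS; pose P := [set q | sublinear q /\ ptwise_le q p].
have Pl x : has_lbound [set f x | f in P].
  exists (- p (- x)) => _ [f [fS fp] <-].
  by apply: le_trans (sublinearN _ fS); rewrite lerN2.
have Pinf (C : set (V -> R)) : C !=set0 -> C `<=` P ->
    total_on C (@ptwise_le R V) -> P (ptwise_inf C).
  move=> [f Cf] CP Ct; have Ci := ptwise_inf_le CP Pl.
  have I0 x : [set f x | f in C] !=set0 by exists (f x); exists f.
  split; last first.
    by move=> x; apply: le_trans (Ci _ Cf x) _; have [_] := CP _ Cf; exact.
  split=> [x x'|t x t0].
    apply: (ler_inf_add (I0 x) (I0 x')) => _ _ [g Cg <-] [h Ch <-].
    have [l Cl [lg lh]] := total_ptwise_le Ct Cg Ch.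
    apply: le_trans (Ci _ Cl _) _; have [[lD _] _] := CP _ Cl.
    by apply: le_trans (lD _ _) _; rewrite lerD.
  apply: (ler_mulr_inf t0 (I0 x)) => _ [g Cg <-]; apply: le_trans (Ci _ Cg _) _.
  by have [[_ gZ] _] := CP _ Cg; exact: gZ.
have shiftP q z : P q -> P (sublinear_shift q z) /\ ptwise_le (sublinear_shift q z) q.
  move=> [qS qp]; have le : ptwise_le (sublinear_shift q z) q.
    move=> x; have := sublinear_shift_le z qS x (lexx 0).
    by rewrite scale0r addr0 mul0r subr0.
  split=> //; split; first exact: sublinear_shift_sublinear.
  by move=> x; exact: le_trans (le x) (qp x).
have Pp : P p by split=> // x.
(* Starting below the shift of [p] along [y], and not merely below [p], is what forces q(y) = p(y)
   at the end. *)
have [Ps _] := shiftP p y Pp.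
have [q [Pq qs qmin]] := exists_minimal_function Pl Pinf Ps.
have [qS qp] := Pq; have [qD qZ] := qS.
have qadd x x' : q (x + x') = q x + q x'.
  apply/eqP; rewrite eq_le qD /=.
  have [Pq' q'q] := shiftP q x' Pq; rewrite -lerBrDr.
  rewrite -{1}(qmin _ Pq' q'q); have := sublinear_shift_le x' qS x ler01.
  by rewrite scale1r mul1r.
exists q; split=> //.
  by move=> t x; exact: sublinearZ.
apply/eqP; rewrite eq_le qp /=.
have : q (- y) <= - p y.
  apply: le_trans (qs _) _; have := sublinear_shift_le y pS (- y) ler01.
  by rewrite scale1r mul1r addNr sublinear0 // sub0r.
rewrite lerNr; suff -> : - q (- y) = q y by [].
by apply/eqP; rewrite eq_sym -addr_eq0 -qadd subrr sublinear0.
Qed.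

(** A real functional q is the real part of the complex one f(x) = q(x) - i q(i x). With k the
    conjugate of f(x), |f(x)|^2 = q(k x) <= |k| p(x), which bounds |f(x)|. At y the real part
    already equals p(y), so the imaginary part vanishes. *)
Lemma hahn_banach_support p y :
  (forall x x', p (x + x') <= p x + p x') ->
  (forall (k : R[i]) x, p (k *: x) = normc k * p x) ->
  exists phi : {linear V -> R[i]^o},
    (forall x, normc (phi x : R[i]) <= p x) /\ phi y = (p y)%:C%C.
Proof.
move=> pD pZ; have pS : sublinear p.
  by split=> // t x t0; rewrite pZ normc_real ger0_norm.
have [q [qD qZ qp qy]] := hahn_banach_real y pS.
have q0 : q 0 = 0 by apply: (addrI (q 0)); rewrite -qD !addr0.
have qN x : q (- x) = - q x.
  by apply/eqP; rewrite -addr_eq0 -qD addNr q0.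
have qR (t : R) x : q (t%:C%C *: x) = t * q x.
  have [t0|/ltW t0] := leP 0 t; first exact: qZ.
  by rewrite -{1}[t]opprK rmorphN scaleNr qN qZ ?oppr_ge0 // mulNr opprK.
pose f x : R[i]^o := (q x -i* q ('i%C *: x))%C.
have flin : linear f.
  move=> k x x'; rewrite /f.
  rewrite scalerDr !qD; case: k => a b.
  have E1 : (a +i* b)%C *: x = a%:C%C *: x + b%:C%C *: ('i%C *: x).
    by rewrite scalerA -scalerDl; congr (_ *: _); simpc.
  have -> : 'i%C *: ((a +i* b)%C *: x) = a%:C%C *: ('i%C *: x) + (- b)%:C%C *: x.
    by rewrite !scalerA -scalerDl; congr (_ *: _); simpc.
  rewrite E1.
  rewrite !qD !qR; apply/eqP; rewrite eq_complex /=.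
  by apply/andP; split; apply/eqP; ring.
pose phi : {linear V -> R[i]^o} :=
  HB.pack_for {linear V -> R[i]^o} f (GRing.isLinear.Build R[i] V R[i]^o _ f flin).
have p_ge0 x : 0 <= p x.
  have pN1 : p (- x) = p x by rewrite -scaleN1r pZ normcN normc1 mul1r.
  by have := pD x (- x); rewrite subrr (sublinear0 pS) pN1 -mulr2n pmulrn_lge0.
have fp x : normc (f x : R[i]) <= p x.
  set k : R[i] := (q x +i* q ('i%C *: x))%C.
  have nk : normc k = normc (f x : R[i]) by rewrite /= sqrrN.
  have qk : q (k *: x) = normc k ^+ 2.
    have -> : q (k *: x) = complex.Re (f (k *: x) : R[i]) by [].
    have -> : f (k *: x) = k *: f x.
      have f0 : f 0 = 0 by rewrite /f scaler0 q0 oppr0.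
      by have := flin k x 0; rewrite f0 !addr0.
    by rewrite /= sqr_sqrtr ?addr_ge0 ?sqr_ge0 // mulrN opprK -!expr2.
  have := qp (k *: x); rewrite qk pZ -nk => kp.
  have := normc_ge0 k; rewrite le_eqVlt => /predU1P[<-|k0]; first exact: p_ge0.
  by move: kp; rewrite expr2 ler_pM2l.
exists phi; split; first exact: fp.
apply/eqP; rewrite eq_complex /= qy eqxx /= oppr_eq0.
have := fp y; rewrite -(ler_sqr (x := normc _)) ?nnegrE ?normc_ge0 ?p_ge0 //=.
rewrite sqr_sqrtr ?addr_ge0 ?sqr_ge0 // qy gerDl sqrrN => y0.
by rewrite -sqrf_eq0 eq_le y0 sqr_ge0.
Qed.

End HahnBanach.

(** * Convex sets in the complex plane *)

Section PlaneConvexity.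
Variable R : realType.
Implicit Types (S H : set R[i]) (w z : R[i]) (t c e M : R).

Lemma complex_gt0_real (k : R[i]) : 0 < k -> exists2 e : R, 0 < e & k = e%:C%C.
Proof.
move=> k0; have /eqP kI : complex.Im k == 0 by move: k0; rewrite ltcE => /andP[].
exists (complex.Re k); first by move: k0; rewrite ltcE => /andP[].
by apply/eqP; rewrite eq_complex /= kI !eqxx.
Qed.

Lemma closure0P (S : set R[i]^o) :
  closure S 0 <-> forall e, 0 < e -> exists2 z : R[i], S z & normc z < e.
Proof.
split=> [S0 e e0|Se B].
  have [|z [Sz]] := S0 (ball (0 : R[i]^o) (e%:C%C)).
    by apply: nbhsx_ballx; rewrite ltcR.
  rewrite -ball_normE /= sub0r normrN => ze; exists z => //.
  by rewrite -ltcR.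
move=> /nbhs_ballP[k /= /complex_gt0_real[e e0 ->] kB].
have [z Sz ze] := Se e e0; exists z; split=> //; apply: kB.
by rewrite -ball_normE /= sub0r normrN; rewrite -ltcR in ze.
Qed.

Definition plane_convex H := forall z w t, 0 <= t -> t <= 1 ->
  H z -> H w -> H (t%:C%C * z + (1 - t)%:C%C * w).

Lemma plane_convexP H :
  plane_convex H <-> @convex_set R[i] R[i]^o H.
Proof.
split=> [HC z w k /set_mem Hz /set_mem Hw|HC z w t t0 t1 Hz Hw].
  apply/mem_set; have k0 : 0 <= k%:inum by []. have k1 : k%:inum <= 1 by [].
  have kR : k%:inum = (complex.Re k%:inum)%:C%C by rewrite RRe_real // ger0_real.
  have t0 : 0 <= complex.Re k%:inum by move: k0; rewrite kR lecR.
  have t1 : complex.Re k%:inum <= 1 by move: k1; rewrite kR lecR.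
  have E t : (1 - t)%:C%C = 1 - t%:C%C :> R[i] by rewrite rmorphB rmorph1.
  by have := HC z w _ t0 t1 Hz Hw; rewrite E -kR.
have t0' : 0 <= t%:C%C :> R[i] by rewrite lecR.
have t1' : t%:C%C <= 1 :> R[i] by rewrite lecR.
have := HC z w (Itv01 t0' t1') (mem_set Hz) (mem_set Hw) => /set_mem.
by rewrite rmorphB rmorph1.
Qed.

Lemma convex_hull_sub S H : plane_convex H -> S `<=` H -> convex_hull S `<=` H.
Proof. by move=> /plane_convexP HC SH z; apply; split. Qed.

Lemma sub_convex_hull S : S `<=` convex_hull S.
Proof. by move=> z Sz H [_ SH]; exact: SH. Qed.

Lemma convex_hull_convex S : plane_convex (convex_hull S).
Proof.
move=> z w t t0 t1 Sz Sw H HP; have [/plane_convexP HC _] := HP.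
by apply: HC => //; [exact: Sz|exact: Sw].
Qed.

Lemma plane_convex_ball l M : plane_convex [set z | normc (l + z) <= M].
Proof.
move=> z w t t0 t1 /= zM wM.
have -> : l + (t%:C%C * z + (1 - t)%:C%C * w) =
    t%:C%C * (l + z) + (1 - t)%:C%C * (l + w).
  by rewrite rmorphB rmorph1; ring.
apply: le_trans (normcD _ _) _; rewrite !normcM !normc_real !ger0_norm ?subr_ge0 //.
rewrite (_ : M = t * M + (1 - t) * M); last by ring.
by rewrite lerD // ler_wpM2l // subr_ge0.
Qed.

(** The disc of centre - l and radius M is convex and contains S, hence its hull; points of the hull
    come arbitrarily close to 0. *)
Lemma closed_convex_hull_ball S l M : (forall z, S z -> normc (l + z) <= M) ->
  closed_convex_hull S 0 -> normc l <= M.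
Proof.
move=> SM /closure0P S0; apply/ler_addgt0Pl => e e0; have [z Sz ze] := S0 e e0.
have zM : normc (l + z) <= M.
  by apply: (convex_hull_sub (@plane_convex_ball l M) _ Sz) => w; exact: SM.
have -> : l = - z + (l + z) by ring.
by apply: le_trans (normcD _ _) _; rewrite normcN lerD // ltW.
Qed.

Definition csqr z : R := complex.Re z ^+ 2 + complex.Im z ^+ 2.

Lemma normc_sqr z : normc z ^+ 2 = csqr z.
Proof. by case: z => a b; rewrite /= sqr_sqrtr // addr_ge0 ?sqr_ge0. Qed.

(* [z0] nearly minimizes the modulus on H; moving from [z0] towards any [z] in H cannot lower the
   modulus much, which bounds the inner product of [z0] and [z] from below. *)
Lemma plane_separation H e M : 0 < e -> plane_convex H ->
  (forall z, H z -> e <= normc z) -> (forall z, H z -> normc z <= M) ->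
  exists w c, 0 < c /\ forall z, H z -> c <= complex.Re (w * z).
Proof.
move=> e0 HC He HM.
have [[z1 Hz1]|nH] := pselect (H !=set0); last first.
  by exists 1, 1; split=> // z Hz; case: nH; exists z.
pose d := inf [set csqr z | z in H].
have D0 : [set csqr z | z in H] !=set0 by exists (csqr z1); exists z1.
have ed : e ^+ 2 <= d.
  apply: lb_le_inf => // _ [z Hz <-]; rewrite -normc_sqr.
  by rewrite ler_sqr ?nnegrE ?normc_ge0 ?(ltW e0) // He.
have d0 : 0 < d by apply: lt_le_trans ed; rewrite exprn_gt0.
have dz z : H z -> d <= csqr z.
  move=> Hz; apply: ge_inf; last by exists z.
  by exists 0 => _ [w _ <-]; rewrite -normc_sqr sqr_ge0.
have M0 : 0 <= M by apply: le_trans (normc_ge0 _) (HM _ Hz1).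
pose N := (M + M) ^+ 2 + 1; have N0 : 0 < N by rewrite ltr_wpDl // sqr_ge0.
(* The step length from z0 towards z. As [N] bounds |z - z0|^2 and t N <= d / 2, the quadratic term
   t^2 |z - z0|^2 is at most t d / 2. *)
pose t := d / (d + 2 * N).
have dN : 0 < d + 2 * N by rewrite addr_gt0 // mulr_gt0.
have t0 : 0 < t by rewrite divr_gt0.
have t1 : t <= 1 by rewrite ler_pdivrMr // mul1r lerDl mulr_ge0 // ltW.
have tN : t * N <= d / 2.
  by rewrite /t mulrAC ler_pdivrMr //; have := mulr_gt0 d0 d0; lra.
have [_ [z0 Hz0 <-] z0d] : exists2 s, [set csqr z | z in H] s & s < d + t * d / 2.
  apply: inf_adherent; first by rewrite divr_gt0 // mulr_gt0.
  by split=> //; exists 0 => _ [w _ <-]; rewrite -normc_sqr sqr_ge0.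
(* Expanding |z0 + t (z - z0)|^2 >= d loses t d / 2 to the choice of z0 and t d / 2 to the quadratic
   term. Dividing by 2 t leaves Re(w z) >= |z0|^2 - d / 2 >= d / 2. *)
exists (z0^*)%C, (d / 2); split; first by rewrite divr_gt0.
move=> z Hz.
have zN : csqr (z - z0) <= N.
  rewrite -normc_sqr /N ler_wpDr //.
  rewrite ler_sqr ?nnegrE ?normc_ge0 ?addr_ge0 //.
  by apply: le_trans (normcD _ _) _; rewrite normcN lerD // HM.
have := dz _ (HC z z0 t (ltW t0) t1 Hz Hz0).
have := dz _ Hz0.
move: z0d zN tN; clearbody t N; clear -d0 t0 t1 N0.
case: z0 => a b; case: z => a' b'; rewrite /csqr /= => z0d zN tN zd.
rewrite !(mul0r, subr0, addr0) => le.
have : t * (d / 2) <= t * (a * a' - - b * b').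
  have : t * t * ((a' - a) ^+ 2 + (b' - b) ^+ 2) <= t * (d / 2).
    apply: le_trans (_ : t * t * N <= _); first by rewrite ler_wpM2l // mulr_ge0 // ltW.
    by rewrite -mulrA ler_wpM2l // ltW.
  nra.
by rewrite ler_pM2l.
Qed.

End PlaneConvexity.

(** * Growth of powers and the character of the unitization *)

(** The constant disappears in the n-th root; cofinally many exponents are enough, so powers of two
    can be used. *)
Lemma ler_of_powers (R : realType) (a b C : R) : 0 <= a -> 0 <= b ->
  (forall N, exists2 n, (N <= n)%N & a ^+ n <= C * b ^+ n) -> a <= b.
Proof.
move=> a0 b0 abC; rewrite leNgt; apply/negP => ba.
have a0' : 0 < a by apply: le_lt_trans ba.
have r0 : 0 <= b / a by rewrite divr_ge0.
have r1 : b / a < 1 by rewrite ltr_pdivrMr ?mul1r.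
have : ((b / a) ^+ n) @[n --> \oo] --> (0 : R) by apply: cvg_expr; rewrite ger0_norm.
have C0 : 0 < `|C| + 1 by rewrite ltr_wpDl.
have Ci : 0 < (`|C| + 1)^-1 by rewrite invr_gt0.
move=> /cvgrPdist_lt /(_ _ Ci) [N _ rN]; have [n Nn abn] := abC N.
have := rN n Nn; rewrite /= sub0r normrN ger0_norm ?exprn_ge0 //.
rewrite expr_div_n ltr_pdivrMr ?exprn_gt0 // ltr_pdivlMl //.
apply/negP; rewrite -leNgt; apply: le_trans abn _.
rewrite ler_wpM2r ?exprn_ge0 //; apply: le_trans (ler_norm C) _.
by rewrite lerDl.
Qed.

Lemma normcX (R : realType) (z : R[i]) n : normc (z ^+ n) = normc z ^+ n.
Proof. by elim: n => [|n ih]; rewrite ?normc1 // !exprS normcM ih. Qed.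

Lemma ler_anormX (R : realType) (A : assocAlgType R[i]) (q : unitization A -> R)
    (x : unitization A) n : algebra_norm q -> q (x ^+ n.+1) <= q x ^+ n.+1.
Proof.
move=> qN; elim: n => [|n ih] //; rewrite exprS [leRHS]exprS.
apply: le_trans (ler_anormM qN _ _) _.
by rewrite ler_wpM2l // anorm_ge0.
Qed.

(** If A is closed, 1 has a distance e > 0 from A, and scaling gives |x.2| <= q(x) / e. The map x ->
    x.2 is multiplicative, so applying this to powers of x removes the factor 1 / e. *)
Lemma closed_character_bound (R : realType) (A : assocAlgType R[i])
    (q : unitization A -> R) : algebra_norm q ->
  closed_for q (range (@to_unitization _ A)) ->
  forall x : unitization A, normc (x.2 : R[i]) <= q x.
Proof.
move=> qN qC.
have [e e0 qe] : exists2 e : R, 0 < e & forall a, e <= q (1 - to_unitization a).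
  apply: contrapT => ne; have := qC 1; rewrite range_to_unitization /= => H.
  have /eqP := oner_neq0 R[i]; apply; apply: H => e e0.
  apply: contrapT => ne'; apply: ne; exists e => // a.
  by rewrite leNgt; apply/negP => ae; apply: ne'; exists (to_unitization a).
have bound (x : unitization A) : normc (x.2 : R[i]) <= e^-1 * q x.
  have [->|k0] := eqVneq (x.2 : R[i]) 0.
    by rewrite normc0; apply: mulr_ge0; [rewrite invr_ge0 ltW|exact: anorm_ge0].
  have {2}-> : x = x.2 *: (1 - to_unitization (- x.2^-1 *: x.1)).
    rewrite scalerBr -to_unitizationZ scalerA mulrN mulfV // scaleN1r.
    have -> : to_unitization (- x.1) = - to_unitization x.1 by exact: linearN.
    by rewrite {1}[x]unitization_eta opprK addrC.
  rewrite anormZ // mulrCA ler_peMr ?normc_ge0 // mulrC ler_pdivlMr // mul1r.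
  exact: qe.
move=> x; apply: (@ler_of_powers _ _ _ e^-1).
- exact: normc_ge0.
- exact: anorm_ge0.
- move=> n; exists n.+1 => //; have := bound (x ^+ n.+1).
  rewrite snd_unitizationX normcX.
  move/le_trans; apply; apply: ler_wpM2l; first by rewrite invr_ge0 ltW.
  exact: ler_anormX.
Qed.

(** * The spectral radius formula by averaging resolvents *)

(** Iterated square roots of -1. Multiplying t by such a root changes the sign of (t x)^(2^k). *)
Lemma normc_eq1_root (R : realType) (k : nat) :
  exists2 z : R[i], z ^+ (2 ^ k) = -1 & normc z = 1.
Proof.
elim: k => [|k [z zE z1]]; first by exists (-1); rewrite ?expr1 // normcN normc1.
exists (sqrtc z); first by rewrite expnS exprM sqr_sqrtc.
apply/eqP; rewrite -(eqrXn2 (n := 2)) ?normc_ge0 //.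
by rewrite -normcX sqr_sqrtc z1 expr1n.
Qed.

Section SpectralRadiusFormula.
Variables (R : realType) (A : assocAlgType R[i]) (p : unitization A -> R).
Hypotheses (pN : algebra_norm p) (p1 : p 1 <= 1).
Variable x : unitization A.
Local Notation Ae := (unitization A).
Implicit Types (s t : R[i]) (u v : Ae).

Let pM u v : p (u * v) <= p u * p v. Proof. exact: ler_anormM. Qed.

Hypothesis x_inv : forall t, normc t <= 1 ->
  exists u, u * (1 - t *: x) = 1 /\ (1 - t *: x) * u = 1.

(** The resolvent (1 - t x)^-1 on the closed unit disc, with default value 0 elsewhere. *)
Let res t : Ae :=
  if pselect (normc t <= 1) is left t1 then projT1 (cid (x_inv t1)) else 0.

Let resP t : normc t <= 1 ->
  res t * (1 - t *: x) = 1 /\ (1 - t *: x) * res t = 1.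
Proof. by rewrite /res; case: pselect => // t1 _; case: cid. Qed.

Let res_eq s t : normc s <= 1 -> normc t <= 1 ->
  res s - res t = (s - t) *: (res s * x * res t).
Proof.
move=> /resP[s1 _] /resP[_ t1].
have -> : (s - t) *: (res s * x * res t) =
    res s * ((1 - t *: x) - (1 - s *: x)) * res t.
  have -> : (1 - t *: x) - (1 - s *: x) = (s - t) *: x.
    by rewrite opprB [LHS]addrC addrA subrK -scalerBl.
  by rewrite -scalerAr -scalerAl.
by rewrite mulrBr mulrBl s1 -mulrA t1 mulr1 mul1r.
Qed.

(** By the resolvent identity, p(res s) - p(res t) <= |s - t| p(res s) p(x) p(res t). The radius
    makes the right side at most p(res s) / 2, which the left side absorbs; the added 1 keeps the
    denominator positive. *)
Let res_locally_bounded t : normc t <= 1 -> exists2 e : R, 0 < e &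
  forall s, normc s <= 1 -> normc (s - t) < e -> p (res s) <= 2 * p (res t).
Proof.
move=> t1; have px := anorm_ge0 pN x; have pt := anorm_ge0 pN (res t).
have e0 : 0 < 2 * (p x * p (res t) + 1).
  by rewrite mulr_gt0 // ltr_wpDl // mulr_ge0.
exists (2 * (p x * p (res t) + 1))^-1; first by rewrite invr_gt0.
move=> s s1; rewrite -[ltRHS]mul1r ltr_pdivlMr // => st.
have ps := anorm_ge0 pN (res s); have nst := normc_ge0 (s - t).
have : p (res s) - p (res t) <= normc (s - t) * (p (res s) * p x * p (res t)).
  apply: le_trans (lerB_anorm pN _ _) _; rewrite res_eq // anormZ //.
  rewrite ler_wpM2l //; apply: le_trans (pM _ _) _.
  by rewrite ler_wpM2r.
move: (p (res s)) (p (res t)) (p x) (normc (s - t)) ps pt px nst st => a b c d.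
move=> a0 b0 c0 d0 dcb h.
suff : d * (a * c * b) <= a / 2 by lra.
have -> : d * (a * c * b) = a * (d * (c * b)) by ring.
by rewrite ler_wpM2l //; nra.
Qed.

Let res_bounded : exists M, forall t, normc t <= 1 -> p (res t) <= M.
Proof.
pose P (M : R) (z : R * R) :=
  normc (z.1 +i* z.2)%C <= 1 -> p (res (z.1 +i* z.2)%C) <= M.
have K : compact (`[-1, 1]%classic `*` `[-1, 1]%classic : set (R * R)).
  by apply: compact_setX; apply: segment_compact.
have close (z w : R * R) e : ball z (e / 2) w ->
    normc ((w.1 +i* w.2)%C - (z.1 +i* z.2)%C) < e.
  move=> -[h1 h2]; rewrite -!ball_normE in h1 h2.
  apply: le_lt_trans (normc_le _) _; rewrite [ltRHS]splitr.
  by apply: ltrD; rewrite /= distrC.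
(* Compactness of the square [-1, 1]^2: a property that holds near each point for all large M holds
   on the whole square for all large M. *)
have [|M [_ hM]] := (compact_near_coveringP _).1 K _ (+oo : set_system R) P _.
  move=> z _; have [z1|z1] := leP (normc (z.1 +i* z.2)%C) 1.
    have [e e0 he] := res_locally_bounded z1.
    exists (ball z (e / 2), [set M | 2 * p (res (z.1 +i* z.2)%C) < M]).
      split; first by apply: nbhsx_ballx; rewrite divr_gt0.
      by exists (2 * p (res (z.1 +i* z.2)%C)); split; rewrite ?num_real.
    move=> [w M] /= [wz zM] w1; apply: le_trans (he _ w1 _) (ltW zM).
    exact: close.
  (* Near a point outside the closed disc, [P] holds vacuously. *)
  have e0 : 0 < normc (z.1 +i* z.2)%C - 1 by rewrite subr_gt0.
  exists (ball z ((normc (z.1 +i* z.2)%C - 1) / 2), setT).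
    by split; [apply: nbhsx_ballx; rewrite divr_gt0|exact: filterT].
  move=> [w M] /= [/close wz _] w1; move: wz; rewrite ltNge => /negP[].
  rewrite lerBlDr.
  have := normcD ((z.1 +i* z.2)%C - (w.1 +i* w.2)%C) (w.1 +i* w.2)%C.
  by rewrite subrK => /le_trans; apply; rewrite -[normc (_ - _)]normcN opprB lerD.
exists (M + 1) => t t1; have := hM (M + 1); rewrite ltrDl ltr01 => /(_ isT).
move=> /(_ (complex.Re t, complex.Im t)) /=; rewrite /P /=; case: t t1 => a b t1.
apply=> //; rewrite !in_itv /= -!ler_norml.
split.
  by apply: le_trans t1; exact: (le_Re_normc (a +i* b)%C).
by apply: le_trans t1; exact: (le_Im_normc (a +i* b)%C).
Qed.

Let root k : R[i] := projT1 (cid2 (@normc_eq1_root R k)).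

Let rootP k : root k ^+ (2 ^ k) = -1 /\ normc (root k) = 1.
Proof. by rewrite /root; case: cid2. Qed.

(* [avg k t] is the inverse of [1 - (t x)^(2^k)], written as a mean of values of the resolvent; this
   is what makes its Lipschitz constant in [t] independent of [k]. *)
Let avg := fix avg k t : Ae :=
  if k is k'.+1 then (2^-1 : R)%:C%C *: (avg k' t + avg k' (root k' * t)) else res t.

(** With w = (t x)^(2^k), the two averaged values invert 1 - w and 1 + w. Half their sum inverts 1 -
    w^2, since both orders of the product (1 - w)(1 + w) give 1 - w^2. *)
Let avgP k t : normc t <= 1 ->
  avg k t * (1 - (t *: x) ^+ (2 ^ k)) = 1 /\
  (1 - (t *: x) ^+ (2 ^ k)) * avg k t = 1.
Proof.
elim: k t => [|k ih] t t1 /=; first by rewrite expr1; exact: resP.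
have [z z1] := rootP k.
have zt1 : normc (root k * t) <= 1 by rewrite normcM z1 mul1r.
have [S1 S2] := ih _ t1; have [T1 T2] := ih _ zt1.
have zE : (root k * t *: x) ^+ (2 ^ k) = - (t *: x) ^+ (2 ^ k).
  by rewrite -scalerA exprZn z scaleN1r.
move: S1 S2 T1 T2; rewrite zE opprK expnS mulnC exprM.
move: (avg k t) (avg k _) ((t *: x) ^+ (2 ^ k)) => S T w S1 S2 T1 T2.
have h : (2^-1 : R)%:C%C *: ((1 + w) + (1 - w)) = 1 :> Ae.
  have -> : (1 + w) + (1 - w) = (2 : R)%:C%C *: 1.
    by rewrite addrACA subrr addr0 rmorph_nat scaler_nat.
  by rewrite scalerA -rmorphM mulVf ?pnatr_eq0 // scale1r.
have wl : 1 - w ^+ 2 = (1 - w) * (1 + w).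
  by rewrite mulrDr mulr1 mulrBl mul1r expr2 addrA subrK.
have wr : 1 - w ^+ 2 = (1 + w) * (1 - w).
  by rewrite mulrBr mulr1 mulrDl mul1r expr2 opprD addrA addrK.
split.
  by rewrite -scalerAl mulrDl {1}wl wr !mulrA S1 T1 !mul1r h.
by rewrite -scalerAr mulrDr {1}wr wl -!mulrA S2 T2 !mulr1 h.
Qed.

(** At k = 0 this is the resolvent identity with the uniform bound on the resolvent. A mean of two
    differences keeps the constant; the unimodular factor [u] absorbs the roots introduced by the
    recursion. *)
Let avg_lipschitz : exists2 K, 0 < K & forall k s t (u : R[i]), normc u = 1 ->
  normc s <= 1 -> normc t <= 1 ->
  p (avg k (u * s) - avg k (u * t)) <= K * normc (s - t).
Proof.
have [M MP] := res_bounded; have px := anorm_ge0 pN x.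
have M0 : 0 <= M by apply: le_trans (anorm_ge0 pN _) (MP 0 _); rewrite normc0.
exists (M * p x * M + 1); first by rewrite ltr_wpDl // !mulr_ge0.
elim=> [|k ih] s t u u1 s1 t1.
  rewrite /= res_eq ?normcM ?u1 ?mul1r // -mulrBr anormZ // normcM u1 mul1r mulrC.
  rewrite ler_wpM2r ?normc_ge0 // ler_wpDr //.
  apply: le_trans (pM _ _) _; rewrite ler_pM ?anorm_ge0 ?MP ?normcM ?u1 ?mul1r //.
  apply: le_trans (pM _ _) _.
  by rewrite ler_wpM2r // MP // normcM u1 mul1r.
have [_ z1] := rootP k; have zu1 : normc (root k * u) = 1 by rewrite normcM z1 u1 mulr1.
rewrite /= !mulrA -scalerBr opprD addrACA anormZ // normc_real ger0_norm //.
rewrite mulrC ler_pdivrMr // mulr_natr mulr2n.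
by apply: le_trans (ler_anormD pN _ _) _; rewrite lerD // ih.
Qed.

Let small (s : R) := exists N, forall k, (N <= k)%N ->
  p ((s%:C%C *: x) ^+ (2 ^ k)) <= 3^-1.

(** Smallness of the powers spreads from s to a nearby t: small powers of s x put the average at s
    near 1, the Lipschitz bound puts the average at t near 1, and this makes the powers of t x
    small. Finitely many steps lead from 0 to 1. *)
Lemma normc_powers_small : small 1.
Proof.
have [K K0 KP] := avg_lipschitz.
have step (s t : R) : 0 <= s -> s <= 1 -> 0 <= t -> t <= 1 ->
    (* The index shift [N.+2] takes a fourth power, and 3^-4 <= 9^-1. Then p(S - 1) <= 1/8, p(T - 1)
       <= 1/8 + 1/8, and v = (T - 1)(1 - v) gives p(v) <= (1 + p(v)) / 4, that is p(v) <= 1/3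
       again. *)
    K * `|s - t| <= 8^-1 -> small s -> small t.
  move=> s0 s1 t0 t1 st [N NP]; exists N.+2 => -[|[|k]] // /NP kN.
  have ns : normc s%:C%C <= 1 by rewrite normc_real ger0_norm.
  have nt : normc t%:C%C <= 1 by rewrite normc_real ger0_norm.
  have := KP k.+2 s%:C%C t%:C%C 1 (normc1 _) ns nt; rewrite !mul1r.
  rewrite -rmorphB normc_real => /le_trans /(_ st).
  have [S1 _] := avgP k.+2 ns; have [T1 _] := avgP k.+2 nt.
  move: S1 T1; move: (avg k.+2 _) (avg k.+2 _) => T S S1 T1 ST.
  have w_small : p ((s%:C%C *: x) ^+ (2 ^ k.+2)) <= 9^-1.
    rewrite !expnSr -mulnA exprM; move: kN; move: (_ ^+ (2 ^ k)) => v v3.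
    apply: le_trans (ler_anormX v 3 pN) _.
    apply: (@le_trans _ _ (3^-1 ^+ 4)); last first.
      have -> : (3^-1 : R) ^+ 4 = 81^-1 by field.
      by lra.
    by rewrite lerXn2r ?nnegrE ?anorm_ge0 ?invr_ge0.
  move: w_small T1 S1; move: (_ ^+ (2 ^ k.+2)) (_ ^+ (2 ^ k.+2)) => v w w9 T1 S1.
  have pw := anorm_ge0 pN w; have pv := anorm_ge0 pN v.
  have pS1 := anorm_ge0 pN (S - 1); have pT1 := anorm_ge0 pN (T - 1).
  have S1_le : p (S - 1) <= 8^-1.
    have : p (S - 1) <= (p (S - 1) + 1) * p w.
      have {1}-> : S - 1 = S * w by rewrite -{1}S1 mulrBr mulr1 subKr.
      apply: le_trans (pM _ _) _; rewrite ler_wpM2r // -lerBlDr.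
      by apply: le_trans (lerB_anorm pN _ _); rewrite lerD2l lerN2.
    nra.
  have T1_le : p (T - 1) <= 4^-1.
    have := ler_anorm_dist pN T S 1; rewrite (anormC pN T S); lra.
  have : p v <= p (T - 1) * (1 + p v).
    have {1}-> : v = (T - 1) * (1 - v).
      by rewrite mulrBl T1 mul1r subKr.
    apply: le_trans (pM _ _) _; rewrite ler_wpM2l //.
    by apply: le_trans (ler_anormB pN _ _) _; rewrite lerD2r.
  nra.
have small0 : small 0.
  exists 0%N => k _; rewrite scale0r expr0n expn_eq0 /= anorm0 //.
(* The interval from 0 to 1 is crossed in n equal steps, each within the range of [step]. *)
have [n n0 nK] : exists2 n : nat, (0 < n)%N & K / n%:R <= 8^-1.
  exists (Num.truncn (8 * K)).+1 => //.
  rewrite ler_pdivrMr ?ltr0n // mulrC ler_pdivlMr // mulrC.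
  exact/ltW/truncnS_gt.
have n0' : 0 < n%:R :> R by rewrite ltr0n.
suff sm j : (j <= n)%N -> small (j%:R / n%:R).
  by rewrite -(divff (lt0r_neq0 n0')); apply: sm.
elim: j => [|j ih jn]; first by rewrite mul0r.
have ge0 i : 0 <= i%:R / n%:R :> R by rewrite divr_ge0.
have le1 i : (i <= n)%N -> i%:R / n%:R <= 1 :> R.
  by move=> iN; rewrite ler_pdivrMr // mul1r ler_nat.
have jK : K * `|j%:R / n%:R - j.+1%:R / n%:R| <= 8^-1.
  rewrite -mulrBl -addn1 natrD opprD addNKr mulNr normrN mul1r.
  by rewrite ger0_norm ?invr_ge0 // ltW.
exact: step (ge0 j) (le1 _ (ltnW jn)) (ge0 _) (le1 _ jn) jK (ih (ltnW jn)).
Qed.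

End SpectralRadiusFormula.

Section SpectralRadiusPowers.
Variables (R : realType) (B : banachAlgType R).

Lemma bnorm_unitization (x : unitization B) : bnorm x = ell1_norm (@bnorm R B) x.
Proof. by []. Qed.

(** For x = b / r, every 1 - t x with |t| <= 1 is invertible because |r / t| >= r exceeds the
    spectral radius. The powers of x of exponent 2^k are therefore eventually at most 1/3. *)
Lemma spectral_radius_powers (b : B) (r : R) : spectral_radius b < r ->
  exists N, forall k, (N <= k)%N ->
    bnorm (to_unitization b ^+ (2 ^ k) : unitization B) <= 3^-1 * r ^+ (2 ^ k).
Proof.
move=> br; have r0 : 0 < r by apply: le_lt_trans br; exact: spectral_radius_ge0.
have pN := bnormN (unitization B).
have p1 : bnorm (1 : unitization B) <= 1.
  rewrite bnorm_unitization /ell1_norm (anorm0 (bnormN B)) add0r.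
  by suff -> : normc ((1 : unitization B).2 : R[i]) = 1 by []; exact: normc1.
pose x : unitization B := (r^-1)%:C%C *: to_unitization b.
have x_inv (t : R[i]) : normc t <= 1 ->
    exists u, u * (1 - t *: x) = 1 /\ (1 - t *: x) * u = 1.
  move=> t1; have [->|t0] := eqVneq t 0.
    by exists 1; rewrite scale0r subr0 mulr1.
  pose k := r%:C%C / t.
  have rC0 : r%:C%C != 0 :> R[i] by rewrite eq_complex /= (gt_eqF r0).
  have k0 : k != 0 by rewrite mulf_neq0 ?invr_eq0.
  have nt0 : 0 < normc t.
    by rewrite lt_def normc_ge0 andbT; apply: contraNneq t0 => /eq0_normc ->.
  have rk : spectral_radius b < normc k.
    rewrite normcM normcV // normc_real ger0_norm ?ltW //.
    by apply: lt_le_trans br _; rewrite ler_pdivlMr // ler_piMr // ltW.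
  have /quasi_invertible_unitization := quasi_invertible_radius k0 rk.
  rewrite -(invertible_for_quasi _ (@unitization_identity _ B)).
  have -> : to_unitization (k^-1 *: b) = t *: x.
    by rewrite to_unitizationZ scalerA invfM invrK mulrC fmorphV.
  by case=> u [u1 u2]; exists u.
have [N hN] := normc_powers_small pN p1 x_inv.
exists N => k /hN; rewrite scale1r exprZn -rmorphXn anormZ // normc_real.
rewrite ger0_norm; last by rewrite exprn_ge0 // invr_ge0 ltW.
rewrite exprVn [leLHS]mulrC.
by rewrite ler_pdivrMr // exprn_gt0.
Qed.

Lemma bnorm_to_unitization (b : B) : bnorm (to_unitization b) = bnorm b.
Proof.
rewrite bnorm_unitization /ell1_norm (_ : normc _ = 0) ?addr0 //; exact: normc0.
Qed.

End SpectralRadiusPowers.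

(** * Spectra of powers in the unitization *)

Lemma spectrum_unitization (R : realType) (A : assocAlgType R[i])
    (x : unitization A) k :
  spectrum x k <-> ~ invertible_for (1 : unitization A) (x - k *: 1).
Proof.
have idA := @unitization_identity _ A.
split=> [[[e eP]|[]]|nx]; last by left; exists (unitization1 A).
  suff -> : e = 1 by [].
  by have [<- _] := idA e; have [_ ->] := eP (unitization1 A).
by case; exists (unitization1 A).
Qed.

(** x - k is a factor of x^n - k^n with a cofactor [s] commuting with it, so k in the spectrum of x
    puts k^n in that of x^n. *)
Lemma invertible_for_subX (K : comNzRingType) (A : assocAlgType K)
    (x : unitization A) (k : K) n :
  invertible_for (1 : unitization A) (x ^+ n - (k ^+ n)%:A) ->
  invertible_for (1 : unitization A) (x - k%:A).
Proof.
have cxk : GRing.comm x k%:A by rewrite /GRing.comm mulr_algl mulr_algr.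
pose s := \sum_(i < n) x ^+ (n.-1 - i) * k%:A ^+ i.
have xs : x ^+ n - (k ^+ n)%:A = (x - k%:A) * s.
  have -> : (k ^+ n)%:A = k%:A ^+ n :> unitization A by rewrite exprZn expr1n.
  exact: subrXX_comm.
have sx : (x - k%:A) * s = s * (x - k%:A).
  apply: commr_sum => i _; apply: commrM; apply: commrX; apply/commr_sym.
    by apply: commrB; [exact: commr_refl|exact: cxk].
  by apply: commrB; [exact/commr_sym|exact: commr_refl].
rewrite xs => -[b []]; rewrite !amul_unitization => b1 b2.
(* Evaluating b s (x - k) s b in two ways; s b is then a two-sided inverse of x - k. *)
have E : s * b = b * s.
  have : b * s * ((x - k%:A) * s * b) = (b * ((x - k%:A) * s)) * (s * b).
    by rewrite [in RHS]sx !mulrA.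
  by rewrite b1 b2 mulr1 mul1r.
exists (s * b); rewrite !amul_unitization; split; first by rewrite mulrA.
by rewrite E -mulrA -sx.
Qed.

(** * SEP of the unitization and closedness of A *)

Section Equivalences.
Variables (R : realType) (A : banachAlgType R).
Hypotheses (A_nonunital : ~ has_identity A) (A_semisimple : semisimple A)
  (A_SEP : SEP A).
Implicit Types (p : A -> R) (q : unitization A -> R).

Lemma SEP_closed q : SEP (unitization A) -> algebra_norm q ->
  closed_for q (range (@to_unitization _ A)).
Proof.
move=> sepAe qN x xS; rewrite range_to_unitization /=.
apply: contrapT => /eqP k0.
have nk : 0 < normc (x.2 : R[i]).
  by rewrite lt_def normc_ge0 andbT; apply: contraNneq k0 => /eq0_normc ->.
have [_ [a _ <-] xa] := xS _ nk.
(* Normalizing the scalar part to 1 makes z a representative of 1 modulo A with q(z) < 1. *)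
pose z := (x.2 : R[i])^-1 *: (x - to_unitization a).
have z2 : z.2 = 1 by rewrite /z /= subr0; exact: mulVf.
have qz : q z < 1 by rewrite anormZ // normcV // mulrC ltr_pdivrMr // mul1r.
clearbody z; have : ~ spectrum z 1.
  by move=> /(SEP_spectrum_le sepAe qN); rewrite normc1 leNgt qz.
rewrite spectrum_quasi ?oner_neq0 // invr1 scale1r => /contrapT[y [yE _]].
(* The scalar part of a quasi-inverse y would satisfy y.2 = 1 + y.2. *)
have /eqP := congr1 snd yE.
by rewrite /= z2 mul1r -subr_eq subrr eq_sym oner_eq0.
Qed.

Lemma spectrum_power_bound q (x : unitization A) k n : algebra_norm q ->
  closed_for q (range (@to_unitization _ A)) -> spectrum x k ->
  normc k ^+ n <= (2 + q 1) * q (x ^+ n).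
Proof.
move=> qN qC /spectrum_unitization xk; pose l : R[i] := x.2.
pose a := (x ^+ n - (l ^+ n)%:A).1.
have aE : to_unitization a = x ^+ n - (l ^+ n)%:A.
  rewrite [RHS]unitization_eta /= snd_unitizationX -/l.
  by rewrite [X in X%:A](_ : _ = 0) ?scale0r ?addr0 //= [l ^+ n *: _]mulr1 subrr.
have ak : spectrum a (k ^+ n - l ^+ n).
  right; split=> // inv; apply: xk; apply: (@invertible_for_subX _ _ _ _ n).
  move: inv; rewrite aE -[unitization1 A]/(1 : unitization A) scalerBl.
  by rewrite opprB addrA subrK.
(* |k^n - l^n| <= q(x^n) + |l|^n q(1) and |l|^n <= q(x^n); adding |l|^n once more gives the constant
   2 + q(1). *)
have := SEP_spectrum_le A_SEP (algebra_norm_restrict qN) ak; rewrite aE => h1.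
have := closed_character_bound qN qC (x ^+ n); rewrite snd_unitizationX => h2.
have h3 : q (x ^+ n - (l ^+ n)%:A) <= q (x ^+ n) + q (x ^+ n) * q 1.
  apply: le_trans (ler_anormB qN _ _) _; rewrite lerD2l anormZ //.
  by rewrite ler_wpM2r // anorm_ge0.
have := normcD (k ^+ n - l ^+ n) (l ^+ n); rewrite subrK -normcX => h4.
move: h2; rewrite -/l => h2.
by apply: le_trans h4 _; move: (normc _) (normc _) h1 h2 => u v h1 h2; lra.
Qed.

(** Positive exponents only: an embedding need not send 1 to an identity. *)
Lemma to_unitization_morphX (B : assocAlgType R[i]) (f : {linear unitization A -> B})
    x n : (forall x y, f (x *a y) = f x *a f y) ->
  to_unitization (f (x ^+ n.+1)) = to_unitization (f x) ^+ n.+1.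
Proof.
move=> fM; elim: n => [|n ih]; first by rewrite !expr1.
by rewrite exprS -amul_unitization fM to_unitizationM ih -exprS.
Qed.

Lemma closed_SEP :
  (forall q, algebra_norm q -> closed_for q (range (@to_unitization _ A))) ->
  SEP (unitization A).
Proof.
move=> qC B f [fI fM] x.
have qN : algebra_norm (fun y => bnorm (f y)).
  have pN := bnormN B; split.
  - by move=> y; exact: anorm_ge0.
  - by move=> y /(anorm_eq0 pN) y0; apply: fI; rewrite y0 linear0.
  - by move=> y z; rewrite linearD; exact: ler_anormD.
  - by move=> k y; rewrite linearZ; exact: anormZ.
  - by move=> y z; rewrite fM; exact: ler_anormM.
apply/eqP; rewrite eq_le; apply/andP; split; last first.
  (* r(f x) <= r(x): the embedding carries quasi-inverses over. *)
  apply: spectral_radius_le => [|k k0 xk]; first exact: spectral_radius_ge0.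
  rewrite -linearZ; apply: quasi_invertible_morph => //.
  exact: quasi_invertible_radius.
apply: spectral_radius_le => [|k k0 xk]; first exact: spectral_radius_ge0.
apply: contrapT; rewrite -spectrum_quasi // => kx.
have [r xr rk] : exists2 r, spectral_radius (f x) < r & r < normc k.
  by exists ((spectral_radius (f x) + normc k) / 2); rewrite (midf_lt xk).
have [N hN] := spectral_radius_powers xr.
have r0 : 0 <= r by apply: le_trans (ltW xr); exact: spectral_radius_ge0.
move: rk; rewrite ltNge => /negP; apply.
(* If |k| > r > r(f x), the powers of exponent 2^j bound |k| by r, a contradiction; these exponents
   are cofinal. *)
apply: (@ler_of_powers _ _ _ ((2 + bnorm (f 1)) * 3^-1)) => //; first exact: normc_ge0.
move=> M; exists (2 ^ (maxn M N))%N.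
  by apply: leq_trans (leq_maxl M N) (ltnW (ltn_expl _ _)).
apply: le_trans (spectrum_power_bound _ qN (qC _ qN) kx) _; rewrite -mulrA.
apply: ler_wpM2l; first by rewrite addr_ge0 // (anorm_ge0 (bnormN B)).
apply: le_trans (hN _ (leq_maxr M N)).
rewrite -(prednK (expn_gt0 2 (maxn M N))) -to_unitization_morphX //.
by rewrite bnorm_to_unitization.
Qed.

End Equivalences.

(** * Spatial numerical ranges and the operator norm *)

Section NumericalRange.
Variables (R : realType) (A : banachAlgType R).
Hypotheses (A_nonunital : ~ has_identity A) (A_semisimple : semisimple A).
Implicit Types (p : A -> R) (q : unitization A -> R).

(** Every unit vector contributes to the spatial range, by Hahn-Banach. *)
Lemma support_functional p x : algebra_norm p -> p x = 1 ->
  exists phi : {linear A -> R[i]^o},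
    [/\ bounded_functional p phi, dual_norm p phi = 1, phi x = 1
      & forall y, normc (phi y : R[i]) <= p y].
Proof.
move=> pN px.
have [phi [phip phix]] := hahn_banach_support x (ler_anormD pN) (anormZ pN).
have phi1 : phi x = 1 by rewrite phix px.
exists phi; split=> //; first by exists 1 => y; rewrite mul1r.
have ub : ubound [set normc (phi x : R[i]) | x in [set x | p x <= 1]] 1.
  by move=> _ [y /= y1 <-]; exact: le_trans (phip y) y1.
apply/eqP; rewrite eq_le; apply/andP; split.
  by apply: ge_sup => //; exists (normc (phi x : R[i])); exists x; rewrite //= px.
apply: ub_le_sup; first by exists 1.
by exists x; rewrite /= ?px // phi1; exact: normc1.
Qed.

(** For a unit vector x with support functional phi, p(x + t a x) >= Re phi(x + t a x) = 1 + t Re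
    phi(a x). The general case follows by scaling. *)
Lemma spatial_range_ge p a (c : R) : algebra_norm p ->
  (forall z, spatial_range p a z -> c <= complex.Re z) ->
  forall (t : R) (y : A), 0 <= t -> (1 + t * c) * p y <= p (y + t%:C%C *: (a *a y)).
Proof.
move=> pN ac t y t0; have [->|y0] := pselect (y = 0).
  by rewrite anorm0 // mulr0 anorm_ge0.
have py := anorm_gt0 pN y0.
pose k : R[i] := (p y)^-1%:C%C; pose x := k *: y.
have nk : normc k = (p y)^-1 by rewrite normc_real ger0_norm // invr_ge0 ltW.
have px : p x = 1 by rewrite anormZ // nk mulVf // gt_eqF.
have [phi [phib phid phix phip]] := support_functional pN px.
have cphi : c <= complex.Re (phi (a *a x) : R[i]) by apply: ac; exists x, phi.
rewrite mulrC -ler_pdivlMl // -nk -(anormZ pN).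
have -> : k *: (y + t%:C%C *: (a *a y)) = x + t%:C%C *: (a *a x).
  by rewrite scalerDr amulZr !scalerA mulrC.
apply: le_trans (phip _).
apply: le_trans (le_Re_normc _); apply: le_trans (ler_norm _).
have -> : phi (x + t%:C%C *: (a *a x)) = 1 + t%:C%C * (phi (a *a x) : R[i]).
  by rewrite linearD; congr (_ + _); [exact: phix|exact: linearZ].
move: cphi; case: (phi (a *a x)) => u v /= cu.
by rewrite mul0r subr0 lerD2l ler_wpM2l.
Qed.

Lemma dual_norm_le p (phi : {linear A -> R[i]^o}) y : algebra_norm p ->
  bounded_functional p phi -> dual_norm p phi = 1 -> normc (phi y : R[i]) <= p y.
Proof.
move=> pN [M phiM] phi1; have [->|y0] := pselect (y = 0).
  by rewrite linear0 anorm0 // normc0.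
have py := anorm_gt0 pN y0.
pose k : R[i] := (p y)^-1%:C%C; have pi : 0 <= (p y)^-1 by rewrite invr_ge0 ltW.
have nk : normc k = (p y)^-1 by rewrite normc_real ger0_norm.
have : normc (phi (k *: y) : R[i]) <= 1.
  rewrite -phi1; apply: ub_le_sup; last first.
    by exists (k *: y) => //=; rewrite anormZ // nk mulVf // gt_eqF.
  exists `|M| => _ [z /= z1 <-]; apply: le_trans (phiM z) _.
  apply: le_trans (_ : `|M| * p z <= _).
    by rewrite ler_wpM2r ?anorm_ge0 ?ler_norm.
  by rewrite -[leRHS]mulr1 ler_wpM2l.
have -> : phi (k *: y) = k * (phi y : R[i]) by exact: linearZ.
by rewrite normcM nk mulrC ler_pdivrMr // mul1r.
Qed.

Lemma closed_spatial_range :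
  (forall q, algebra_norm q -> closed_for q (range (@to_unitization _ A))) ->
  forall p, algebra_norm p -> forall a, closed_convex_hull (spatial_range p a) 0.
Proof.
move=> qC p pN a; apply: contrapT => /closure0P h0.
have [e e0 he] : exists2 e : R, 0 < e &
    forall z, convex_hull (spatial_range p a) z -> e <= normc z.
  apply: contrapT => ne; apply: h0 => e e0; apply: contrapT => nz; apply: ne.
  exists e => // z Sz; rewrite leNgt; apply/negP => ze; apply: nz.
  by exists z.
have hM z : convex_hull (spatial_range p a) z -> normc z <= p a.
  move=> Sz; rewrite -[z]add0r.
  apply: (convex_hull_sub (@plane_convex_ball R 0 (p a)) _ Sz).
  move=> _ [x [phi [px phib phid _ ->]]] /=; rewrite add0r.
  apply: le_trans (dual_norm_le _ pN phib phid) _.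
  by have := ler_anormM pN a x; rewrite px mulr1.
have [w [c [c0 wc]]] := plane_separation e0 (@convex_hull_convex _ _) he hM.
(* Multiplication by the separating [w] moves the numerical range into the half-plane Re >= c. *)
pose b := w *: a.
have bc z : spatial_range p b z -> c <= complex.Re z.
  move=> [x [phi [px phib phid phix ->]]].
  have -> : phi (b *a x) = w * (phi (a *a x) : R[i]).
    by rewrite /b amulZl; exact: linearZ.
  by apply: wc; apply: sub_convex_hull; exists x, phi.
have lower := spatial_range_ge pN bc.
pose Q := p (b *a b); have Q0 : 0 <= Q by exact: anorm_ge0.
(* Chosen so that t Q < c, hence 1 + t^2 Q < 1 + t c. *)
pose t := c / (Q + 1).
have Q1 : 0 < Q + 1 by rewrite ltr_wpDl.
have t0 : 0 < t by rewrite divr_gt0.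
have tQ : t * Q < c by rewrite /t mulrAC ltr_pdivrMr // ltr_pM2l // ltrDl.
have oN := op_norm_algebra_norm pN A_semisimple A_nonunital.
(* u = 1 - t b has scalar part 1, so closedness forces its operator norm to be at least 1; the rest
   shows that it is smaller. *)
pose u : unitization A := 1 + (- t%:C%C) *: to_unitization b.
have := closed_character_bound oN (qC _ oN) u.
have -> : (u.2 : R[i]) = 1 by rewrite /u /=; exact: (etrans (congr1 _ (mulr0 _)) (addr0 _)).
rewrite normc1; apply/negP; rewrite -ltNge.
have tc : 0 < 1 + t * c by rewrite addr_gt0 // mulr_gt0.
apply: (@le_lt_trans _ _ ((1 + t ^+ 2 * Q) / (1 + t * c))); last first.
  by rewrite ltr_pdivrMr // mul1r ltrD2l expr2 -mulrA ltr_pM2l.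
apply: op_norm_le => // [|y].
  apply: divr_ge0 (ltW tc).
  by rewrite addr_ge0 // mulr_ge0 // sqr_ge0.
rewrite mulrAC ler_pdivlMr // mulrC.
have uE : uact u y = y + (- t%:C%C) *: (b *a y).
  by rewrite uactD uact1 uactZ uact_to_unitization.
(* The lower bound for 1 + t b is applied to u y, because (1 + t b)(1 - t b) = 1 - t^2 b^2. *)
apply: le_trans (lower t (uact u y) (ltW t0)) _.
have -> : uact u y + t%:C%C *: (b *a uact u y) = y - (t ^+ 2)%:C%C *: (b *a b *a y).
  rewrite uE amulDr amulZr scalerDr scalerA !amulA scaleNr addrA addrNK.
  by rewrite mulrN -rmorphM expr2 scaleNr.
apply: le_trans (ler_anormB pN _ _) _; rewrite mulrDl mul1r lerD2l anormZ //.
rewrite normc_real ger0_norm ?sqr_ge0 // -[leRHS]mulrA.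
by apply: ler_wpM2l; [exact: sqr_ge0|exact: ler_anormM].
Qed.

(** For x = a + l, each point phi(a y) of the range satisfies l + phi(a y) = phi(x y), of modulus at
    most the operator norm of x. The range lies in a disc centred at - l whose radius is that
    norm. *)
Lemma spatial_range_character_bound p : algebra_norm p ->
  (forall a, closed_convex_hull (spatial_range p a) 0) ->
  forall x : unitization A, normc (x.2 : R[i]) <= op_norm p x.
Proof.
move=> pN p0 x; apply: closed_convex_hull_ball (p0 x.1).
move=> _ [y [phi [py phib phid phiy ->]]].
have -> : (x.2 : R[i]) + phi (x.1 *a y) = phi (uact x y).
  rewrite /uact linearD addrC; congr (_ + _).
  by rewrite linearZ phiy; exact/esym/mulr1.
apply: le_trans (dual_norm_le _ pN phib phid) _.
by apply: le_trans (op_normP pN _ _) _; rewrite py mulr1.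
Qed.

Lemma minimal_norm_equivalence q : minimal_norm q ->
  (forall p, algebra_norm p -> forall a, closed_convex_hull (spatial_range p a) 0) ->
  equivalent_norms (op_norm (fun a : A => q (to_unitization a)))
    (ell1_norm (fun a : A => q (to_unitization a))).
Proof.
move=> [qN qmin] p0; set p := fun a : A => _.
have pN : algebra_norm p by exact: algebra_norm_restrict.
have oN := op_norm_algebra_norm pN A_semisimple A_nonunital.
have oq := qmin _ oN (op_norm_le_norm qN).
(* Minimality makes q its own operator norm, so q(1) <= 1. For x = a + l this gives |l| <= q(x) and
   q(a) <= q(x) + |l| q(1) <= 2 q(x), whence 3. *)
exists 1, 3; split=> // x; rewrite mul1r; split; first exact: op_norm_le_ell1.
have xb := spatial_range_character_bound pN (p0 _ pN) x.
have q1 : q 1 <= 1 by rewrite -oq; exact: op_norm1.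
have : p x.1 <= q x + normc (x.2 : R[i]) * q 1.
  rewrite -(anormZ qN); apply: le_trans (ler_anormB qN _ _).
  by rewrite {2}[x]unitization_eta addrK.
rewrite /ell1_norm -oq; have := normc_ge0 (x.2 : R[i]).
by move: (normc _) xb => v xb v0 h; nra.
Qed.

End NumericalRange.

(** * Existence of minimal norms and closedness of A *)

Section MinimalNorms.
Variables (R : realType) (A : banachAlgType R).
Hypotheses (A_nonunital : ~ has_identity A) (A_semisimple : semisimple A)
  (A_SEP : SEP A).
Local Notation Ae := (unitization A).
Implicit Types (f q : Ae -> R).

Let norms : set (Ae -> R) := [set f | algebra_norm f].

Let norms_lb x : has_lbound [set f x | f in norms].
Proof. by exists 0 => _ [f fN <-]; exact: anorm_ge0. Qed.

Section Chain.
Variable C : set (Ae -> R).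
Hypotheses (C0 : C !=set0) (CN : C `<=` norms) (Ct : total_on C (@ptwise_le R Ae)).
Local Notation m := (ptwise_inf C).

Let values_n0 x : [set f x | f in C] !=set0.
Proof. by case: C0 => f Cf; exists (f x); exists f. Qed.

Let values_ge0 x : lbound [set f x | f in C] 0.
Proof. by move=> _ [f Cf <-]; exact: anorm_ge0 (CN Cf) x. Qed.

Let m_le f : C f -> ptwise_le m f.
Proof. exact: ptwise_inf_le CN norms_lb. Qed.

Let m_ge0 x : 0 <= m x.
Proof. exact: lb_le_inf. Qed.

Let mD x y : m (x + y) <= m x + m y.
Proof.
apply: (ler_inf_add (values_n0 x) (values_n0 y)) => _ _ [f Cf <-] [g Cg <-].
have [h Ch [hf hg]] := total_ptwise_le Ct Cf Cg.
apply: le_trans (m_le Ch _) _; apply: le_trans (ler_anormD (CN Ch) _ _) _.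
by rewrite lerD.
Qed.

Let mM x y : m (x *a y) <= m x * m y.
Proof.
apply: (ler_inf_mul (values_n0 x) (values_n0 y)) => // _ _ [f Cf <-] [g Cg <-].
have [h Ch [hf hg]] := total_ptwise_le Ct Cf Cg.
apply: le_trans (m_le Ch _) _; apply: le_trans (ler_anormM (CN Ch) _ _) _.
by rewrite ler_pM // (anorm_ge0 (CN Ch)).
Qed.

Let mZ k x : m (k *: x) = normc k * m x.
Proof.
have le l y : m (l *: y) <= normc l * m y.
  apply: (ler_mulr_inf (normc_ge0 l) (values_n0 y)) => _ [f Cf <-].
  by apply: le_trans (m_le Cf _) _; rewrite (anormZ (CN Cf)).
apply/eqP; rewrite eq_le le /=.
have [->|k0] := eqVneq k 0; first by rewrite normc0 mul0r.
have nk : 0 < normc k.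
  by rewrite lt_def normc_ge0 andbT; apply: contraNneq k0 => /eq0_normc ->.
have := le k^-1 (k *: x); rewrite scalerA mulVf // scale1r normcV //.
by rewrite mulrC ler_pdivlMr // mulrC.
Qed.

(** The zeros of [m] in A form a left ideal. An element b that is not quasi-invertible has 1 in its
    spectrum, so every norm of the chain, and hence [m], is at least 1 at b. The ideal is thus
    quasi-invertible, and semisimplicity makes it zero. *)
Let m_to_unitization (a : A) : m (to_unitization a) = 0 -> a = 0.
Proof.
pose L : set A := [set b | m (to_unitization b) = 0].
have m0 x : m x <= 0 -> m x = 0.
  by move=> x0; apply/eqP; rewrite eq_le x0 m_ge0.
have LI : left_ideal L.
  split=> /=.
  - by apply: m0; rewrite -(scale0r 0) to_unitizationZ mZ normc0 mul0r.
  - move=> x y x0 y0; apply: m0; rewrite to_unitizationD.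
    by apply: le_trans (mD _ _) _; rewrite x0 y0 addr0.
  - by move=> k x x0; rewrite /L /= to_unitizationZ mZ x0 mulr0.
  - move=> b x x0; apply: m0; rewrite to_unitizationM.
    by apply: le_trans (mM _ _) _; rewrite x0 mulr0.
have Lq b : L b -> quasi_invertible b.
  move=> b0; rewrite -[b]scale1r -invr1.
  apply: contrapT; rewrite -spectrum_quasi ?oner_neq0 // => sb.
  have : 1 <= m (to_unitization b).
    apply: lb_le_inf => // _ [f Cf <-]; rewrite -(normc1 R).
    exact: SEP_spectrum_le A_SEP (algebra_norm_restrict (CN Cf)) sb.
  by rewrite b0 ler10.
by move=> a0; exact: semisimple_quasi_invertible_ideal LI Lq a0.
Qed.

(** If m(x) = 0, then [m] vanishes at x y for every y in A, so x acts as zero on A and is zero by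
    faithfulness. *)
Lemma ptwise_inf_algebra_norm : algebra_norm m.
Proof.
split=> // x x0; apply: (unitization_faithful A_semisimple A_nonunital) => y.
apply: m_to_unitization; apply/eqP; rewrite eq_le m_ge0 andbT.
rewrite -/(uact x y) to_unitization_uact.
by apply: le_trans (mM _ _) _; rewrite x0 mul0r.
Qed.

End Chain.

Lemma exists_minimal_norm q : algebra_norm q ->
  exists2 m, minimal_norm m & forall x, m x <= q x.
Proof.
move=> qN.
have [m [mN mq mmin]] := exists_minimal_function norms_lb ptwise_inf_algebra_norm qN.
by exists m => //; split=> // r rN /(mmin _ rN) -> .
Qed.

(** An element with scalar part l keeps a distance of at least |l| / D from A: for each of its
    translates by A, |l| is at most the l1-norm, which is at most D times the operator norm, hence
    at most D m and D q. *)
Lemma minimal_norm_closed :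
  (forall m, minimal_norm m ->
    equivalent_norms (op_norm (fun a : A => m (to_unitization a)))
      (ell1_norm (fun a : A => m (to_unitization a)))) ->
  forall q, algebra_norm q -> closed_for q (range (@to_unitization _ A)).
Proof.
move=> eqv q /exists_minimal_norm[m mmin mq] x xS; rewrite range_to_unitization /=.
apply: contrapT => /eqP k0; have [mN _] := mmin.
have nk : 0 < normc (x.2 : R[i]).
  by rewrite lt_def normc_ge0 andbT; apply: contraNneq k0 => /eq0_normc ->.
have [c [D [_ D0 bound]]] := eqv m mmin.
have [_ [a _ <-] xa] := xS _ (divr_gt0 nk D0).
have [_ h] := bound (x - to_unitization a).
have : normc (x.2 : R[i]) <= D * q (x - to_unitization a).
  apply: (@le_trans _ _ (D * op_norm (fun a : A => m (to_unitization a)) (x - to_unitization a))).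
    apply: le_trans h; rewrite /ell1_norm /= subr0 lerDr.
    exact: anorm_ge0.
  apply: ler_wpM2l; first exact: ltW.
  apply: le_trans (mq _).
  exact: op_norm_le_norm.
by rewrite leNgt mulrC -ltr_pdivlMr // xa.
Qed.

End MinimalNorms.

Unset Implicit Arguments.

Theorem theorem2p8 (R : realType) (A : banachAlgType R)
    (A_nonunital : ~ has_identity A) (A_semisimple : semisimple A)
    (A_SEP : SEP A) :
  [<-> SEP (unitization A);
       forall p : unitization A -> R, algebra_norm p ->
                 closed_for p (range (@to_unitization _ A));
       forall p : A -> R, algebra_norm p ->
                 forall a : A, closed_convex_hull (spatial_range p a) 0;
       forall p : unitization A -> R, minimal_norm p ->
                 equivalent_norms
                   (op_norm (fun a : A => p (to_unitization a)))
                   (ell1_norm (fun a : A => p (to_unitization a)))].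
Proof.
tfae.
- by move=> sepAe q qN; exact: SEP_closed.
- by move=> qC p pN a; exact: closed_spatial_range.
- by move=> p0 q qmin; exact: minimal_norm_equivalence.
(* The cycle closes by returning to the second statement. *)
- move=> eqv; apply: closed_SEP => // q qN; exact: minimal_norm_closed.
Qed.
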